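(* Let $(\omega,\tau_1,\dots,\tau_p)$ be an almost cosymplectic structure of order $p$ on a $(2n+p)$-dimensional manifold $M$, and let $B=\omega+\sum_{k=1}^p\tau_k\otimes\tau_k$ be its associated non-degenerate 2-covariant tensor field. The bivector field $\Lambda=-(\mathsf\Lambda^2\widehat B^{-1})(\omega)$ can be completed to a Jacobi structure if, and only if, there exist a horizontal 1-form $\overline\alpha\in\Gamma(\mathcal H^* )$ and functions $\lambda_1,\dots,\lambda_p\in\mathscr C^\infty(M)$ such that: (i) $(\mathsf\Lambda^3\,{}^{t}\mathrm{pr}_{\mathcal H})(\mathrm d\omega)=\overline\alpha\wedge(\mathsf\Lambda^2\,{}^{t}\mathrm{pr}_{\mathcal H})(\omega)$; (ii) for every $k=1,\dots,p$, $(\mathsf\Lambda^2\,{}^{t}\mathrm{pr}_{\mathcal H})(\mathrm d\tau_k)=\lambda_k\cdot(\mathsf\Lambda^2\,{}^{t}\mathrm{pr}_{\mathcal H})(\omega)$; (iii) letting $X_\alpha=X_{\overline\alpha}-\sum_{k=1}^p\lambda_kR_k$ with $X_{\overline\alpha}=({}^{t}\widehat B)^{-1}(\overline\alpha)$ and $R_k=\widehat B^{-1}(\tau_k)$, for every $k=1,\dots,p$, $${}^{t}\mathrm{pr}_{\mathcal H}(\iota_{X_\alpha}\mathrm d\tau_k)={}^{t}\mathrm{pr}_{\mathcal H}(\mathrm d\lambda_k)\qquad\text{and}\qquad(\mathsf\Lambda^2\,{}^{t}\mathrm{pr}_{\mathcal H})(\mathscr L_{X_\alpha}\omega)=0,$$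 or, equivalently, $(\iota_{X_\alpha}\mathrm d\tau_k-\mathrm d\lambda_k)\wedge\tau_1\wedge\cdots\wedge\tau_p=0$ and $(\mathscr L_{X_\alpha}\omega)\wedge\tau_1\wedge\cdots\wedge\tau_p=0$, respectively. Under these conditions, the Jacobi structure is given by $\Lambda=-(\mathsf\Lambda^2\widehat B^{-1})(\omega)$ and $E=X_\alpha$.
   Context: Manifolds are smooth and paracompact, and all objects are smooth. An almost cosymplectic structure of order $p$ on a $(2n+p)$-dimensional manifold $M$ is a tuple $(\omega,\tau_1,\dots,\tau_p)$ with $\omega\in\Omega^2(M)$ and $\tau_1,\dots,\tau_p\in\Omega^1(M)$ such that $\omega^n\wedge\tau_1\wedge\cdots\wedge\tau_p$ is nowhere vanishing and $\omega^{n+1}=0$. Write $\widehat B(v)=B(v,\cdot)$ and ${}^{t}\widehat B(v)=B(\cdot,v)$, both isomorphisms $\mathrm TM\to \mathrm T^*M$. Then $\mathrm TM=\mathcal H\oplus\mathcal V$ with $\mathcal H=\bigcap_k\operatorname{Ker}\tau_k$ and $\mathcal V=\operatorname{Ker}\omega$ (the kernel of $v\mapsto\omega(v,\cdot)$). Explicitly, $\Lambda(\alpha,\beta)=-\omega(\widehat B^{-1}(\alpha),\widehat B^{-1}(\beta))$. The vector fields $R_k$ are the unique ones with $\iota_{R_k}\omega=0$, $\tau_j(R_k)=\delta_{jk}$. $\mathrm{pr}_{\mathcal H}$ is the projection onto $\mathcal H$ along $\mathcal V$, and $\big((\mathsf\Lambda^j\,{}^{t}\mathrm{pr}_{\mathcal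 H})(\gamma)\big)(X_1,\dots,X_j)=\gamma(\mathrm{pr}_{\mathcal H}X_1,\dots,\mathrm{pr}_{\mathcal H}X_j)$. A section of $\mathcal H^*$ is identified with a 1-form on $M$ vanishing on $\mathcal V$. $\mathscr L$ is the Lie derivative, $\iota$ the contraction. A Jacobi structure is a pair $(\Lambda,E)$ of a bivector field and a vector field with $[\Lambda,\Lambda]=-2E\wedge\Lambda$ and $[\Lambda,E]=0$; $\Lambda$ can be completed to a Jacobi structure if such an $E$ exists. Here $[\cdot,\cdot]$ is the Schouten–Nijenhuis bracket with the sign convention: it extends the Lie bracket of vector fields, $[X,f]=X(f)$, $[P,Q]=-(-1)^{(p-1)(q-1)}[Q,P]$ and $[P,Q\wedge R]=[P,Q]\wedge R+(-1)^{(p-1)q}Q\wedge[P,R]$ for multivector fields of degrees $p,q,r$; the determinant convention is used for wedge products. *)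

(* Defs.v *)
From HB Require Import structures.
From mathcomp Require Import all_boot all_order all_algebra all_fingroup.
From mathcomp Require Import all_classical all_reals all_analysis.

Set Implicit Arguments.
Unset Strict Implicit.
Unset Printing Implicit Defensive.

Import Order.TTheory GRing.Theory Num.Theory.
Import numFieldNormedType.Exports.

Local Open Scope classical_set_scope.
Local Open Scope ring_scope.

Section Smooth.
Variables (R : realType) (m : nat) (W : normedModType R).

Fixpoint Ck (k : nat) (A : set 'rV[R]_m) (f : 'rV[R]_m -> W) : Prop :=
  match k with
  | 0 => forall x, A x -> {for x, continuous f}
  | k'.+1 => (forall x, A x -> differentiable f x) /\
             (forall i : 'I_m, Ck k' A (fun x => 'D_(delta_mx 0 i) f x))
  end.

(* Only meaningful for an open set A: values of f off A play no role. *)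
Definition smooth_on (A : set 'rV[R]_m) (f : 'rV[R]_m -> W) : Prop :=
  forall k, Ck k A f.

End Smooth.

Definition paracompact (T : topologicalType) : Prop :=
  forall U : set (set T),
    (forall A, U A -> open A) -> (forall x, exists2 A, U A & A x) ->
  exists V : set (set T),
    [/\ (forall B, V B -> open B),
        (forall x, exists2 B, V B & B x),
        (forall B, V B -> exists2 A, U A & B `<=` A)
      & (forall x : T, exists2 N, nbhs x N &
           finite_set [set B | V B /\ B `&` N !=set0])].

(* cmap c and cinv c are total functions whose values matter only on csrc c
   and on ctgt c respectively. *)
Record manifold (R : realType) (m : nat) := Manifold {
  mpoint :> topologicalType;
  chart : Type;
  csrc : chart -> set mpoint;
  ctgt : chart -> set 'rV[R]_m;
  cmap : chart -> mpoint -> 'rV[R]_m;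
  cinv : chart -> 'rV[R]_m -> mpoint;
  csrc_open : forall c, open (csrc c);
  ctgt_open : forall c, open (ctgt c);
  cmap_tgt : forall c x, csrc c x -> ctgt c (cmap c x);
  cinv_src : forall c u, ctgt c u -> csrc c (cinv c u);
  cmapK : forall c x, csrc c x -> cinv c (cmap c x) = x;
  cinvK : forall c u, ctgt c u -> cmap c (cinv c u) = u;
  cmap_continuous : forall c x, csrc c x -> {for x, continuous (cmap c)};
  cinv_continuous : forall c u, ctgt c u -> {for u, continuous (cinv c)};
  chart_cover : forall x, exists c, csrc c x;
  transition_smooth : forall c c',
    smooth_on (ctgt c `&` cinv c @^-1` csrc c') (cmap c' \o cinv c);
  manifold_hausdorff : hausdorff_space mpoint;
  manifold_paracompact : paracompact mpoint
}.

(* A k-tuple of vectors (or of covectors) of R^m is the k x m matrix having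
   them as rows, so a k-linear form is a function of a k x m matrix. The same
   type serves for covariant tensors (arguments: vectors) and contravariant
   tensors (arguments: covectors, as rows of coordinates in the dual basis). *)

Definition tensor (R : realType) (m k : nat) := 'M[R]_(k, m) -> R.

Section Pointwise.
Variables (R : realType) (m : nat).
Implicit Types (k l : nat).

Definition multilinear k (a : tensor R m k) : Prop :=
  forall (v v1 v2 : 'M[R]_(k, m)) (i : 'I_k) (b1 b2 : R),
    row i v = b1 *: row i v1 + b2 *: row i v2 ->
    row' i v1 = row' i v -> row' i v2 = row' i v ->
    a v = b1 * a v1 + b2 * a v2.

Definition alternating k (a : tensor R m k) : Prop :=
  forall (v : 'M[R]_(k, m)) (i j : 'I_k),
    i != j -> row i v = row j v -> a v = 0.

Definition tprod k l (a : tensor R m k) (b : tensor R m l) :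
    tensor R m (k + l) :=
  fun v => a (usubmx v) * b (dsubmx v).

(* Determinant convention: (a /\ b)(v1, v2) = a v1 * b v2 - a v2 * b v1 for
   one-forms a and b. *)
Definition wedge k l (a : tensor R m k) (b : tensor R m l) :
    tensor R m (k + l) :=
  fun v => (k`! * l`!)%:R^-1 *
    \sum_(s : 'S_(k + l)) (-1) ^+ s * tprod a b (row_perm s v).

Fixpoint wedge_pow (w : tensor R m 2) (n : nat) : tensor R m (n * 2) :=
  match n with
  | 0 => fun=> 1
  | n'.+1 => wedge w (@wedge_pow w n')
  end.

Fixpoint wedge_all (p : nat) : ('I_p -> tensor R m 1) -> tensor R m p :=
  match p with
  | 0 => fun _ _ => 1
  | p'.+1 => fun t => wedge (t ord0) (wedge_all (fun i => t (lift ord0 i)))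
  end.

Definition contract k (x : 'rV[R]_m) (a : tensor R m (1 + k)) : tensor R m k :=
  fun v => a (col_mx x v).

(* (Lambda^k tf)(a) for the endomorphism f of R^m acting on row vectors. *)
Definition pullback k (f : 'M[R]_m) (a : tensor R m k) : tensor R m k :=
  fun v => a (v *m f).

Definition covec (a : tensor R m 1) : 'rV[R]_m := \row_j a (delta_mx 0 j).

Definition vec1 (x : 'rV[R]_m) : tensor R m 1 := fun eta => (eta *m x^T) 0 0.

Definition rows2 (x y : 'rV[R]_m) : 'M[R]_(1 + 1, m) := col_mx x y.

(* Matrix, acting on row vectors, of the map v |-> b(v, _) from vectors to
   covectors; its transpose is the matrix of v |-> b(_, v). *)
Definition hat (b : tensor R m 2) : 'M[R]_m :=
  \matrix_(i, j) b (rows2 (delta_mx 0 i) (delta_mx 0 j)).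

Section Cosymplectic.
Variables (p : nat) (w : tensor R m 2) (tau : 'I_p -> tensor R m 1).

Definition Btensor : tensor R m 2 :=
  fun v => w v + \sum_k tprod (tau k) (tau k) v.

(* hat Btensor is invertible when (w, tau) comes from an almost cosymplectic
   structure; invmx returns a junk value otherwise. *)
Definition Bhat_inv (a : 'rV[R]_m) : 'rV[R]_m := a *m invmx (hat Btensor).

Definition tBhat_inv (a : 'rV[R]_m) : 'rV[R]_m := a *m invmx (hat Btensor)^T.

Definition Reeb (k : 'I_p) : 'rV[R]_m := Bhat_inv (covec (tau k)).

(* Lambda(a, b) = - w(Bhat^-1 a, Bhat^-1 b), a and b being the rows of eta. *)
Definition Lam : tensor R m 2 := fun eta => - w (eta *m invmx (hat Btensor)).

(* The row spaces of the next two matrices are \bigcap_k Ker (tau k) and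
   Ker w; prH projects onto the first one along the second one. *)
Definition Hspace : 'M[R]_m :=
  kermx (\matrix_(i < m, k < p) tau k (delta_mx 0 i)).

Definition Vspace : 'M[R]_m := kermx (hat w).

Definition prH : 'M[R]_m := proj_mx Hspace Vspace.

End Cosymplectic.
End Pointwise.

Arguments wedge_pow {R m} w n _.

(* The formulas below are the coordinate expressions of the natural operators
   of the calculus on manifolds. *)

Section Local.
Variables (R : realType) (m : nat).

Definition lfield k := 'rV[R]_m -> tensor R m k.

(* For constant vector fields v_i the Lie brackets in the invariant formula
   for the exterior derivative vanish. *)
Definition dext k (a : lfield k) : lfield k.+1 := fun u v =>
  \sum_(i < k.+1) (-1) ^+ i * 'D_(row i v) (fun y => a y (row' i v)) u.

Definition dfun (f : 'rV[R]_m -> R) : lfield 1 := fun u v => 'D_v f u.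

(* (L_X a)(v) = X(a(v)) - \sum_i a(.., [X, v_i], ..), with v_i constant, so
   that [X, v_i] = - D_{v_i} X. *)
Definition lie k (X : 'rV[R]_m -> 'rV[R]_m) (a : lfield k) : lfield k :=
  fun u v => 'D_(X u) (fun y => a y v) u +
    \sum_(i < k) a u (\matrix_j if j == i then 'D_(row i v) X u else row j v).

(* The Schouten-Nijenhuis bracket of multivector fields of positive degrees,
     [P, Q] = \sum_l P(.., dx^l) /\ d_l Q - d_l P /\ Q(dx^l, ..).
   It is the Lie bracket in degrees (1, 1), [X, Q] = L_X Q for a vector field
   X, and the two sign rules
     [P, Q] = - (-1)^((p-1)(q-1)) [Q, P]  and
     [P, Q /\ S] = [P, Q] /\ S + (-1)^((p-1)q) Q /\ [P, S]
   hold for P, Q of degrees p, q; with [X, f] = X(f) they determine it. *)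
Definition schouten p q (P : lfield (p + 1)) (Q : lfield (1 + q)) :
    lfield (p + (1 + q)) := fun u eta =>
  \sum_(l < m)
    (wedge (fun z => P u (col_mx z (delta_mx 0 l)))
           (fun z => 'D_(delta_mx 0 l) (fun y => Q y z) u) eta
     - wedge (fun z => 'D_(delta_mx 0 l) (fun y => P y z) u)
             (contract (delta_mx 0 l) (Q u))
             (castmx (addnA p 1 q, erefl m) eta)).

End Local.

(* A field is a family of local expressions, one for each chart of the atlas,
   subject to smoothness and to the transformation rule under changes of
   charts. The expression in the chart c is relevant only on ctgt c. *)

Section Fields.
Variables (R : realType) (m : nat) (M : manifold R m).

Definition tfield k := chart M -> lfield R m k.

Definition vfield := chart M -> 'rV[R]_m -> 'rV[R]_m.

Definition transJ (c c' : chart M) (x : M) : 'M[R]_m :=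
  jacobian (cmap c' \o cinv c) (cmap c x).

Definition smooth_function (f : M -> R) : Prop :=
  forall c : chart M, smooth_on (ctgt c) (f \o cinv c).

Record is_vector_field (X : vfield) : Prop := IsVectorField {
  vector_field_smooth : forall c, smooth_on (ctgt c) (X c);
  vector_field_change : forall c c' x, csrc c x -> csrc c' x ->
    X c' (cmap c' x) = X c (cmap c x) *m transJ c c' x
}.

Record is_form k (a : tfield k) : Prop := IsForm {
  form_multilinear : forall c u, ctgt c u -> multilinear (a c u);
  form_alternating : forall c u, ctgt c u -> alternating (a c u);
  form_smooth : forall c v, smooth_on (ctgt c) (fun u => a c u v);
  form_change : forall c c' x v, csrc c x -> csrc c' x ->
    a c (cmap c x) v = a c' (cmap c' x) (v *m transJ c c' x)
}.

Record is_multivector k (P : tfield k) : Prop := IsMultivector {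
  mv_multilinear : forall c u, ctgt c u -> multilinear (P c u);
  mv_alternating : forall c u, ctgt c u -> alternating (P c u);
  mv_smooth : forall c eta, smooth_on (ctgt c) (fun u => P c u eta);
  mv_change : forall c c' x eta, csrc c x -> csrc c' x ->
    P c' (cmap c' x) eta = P c (cmap c x) (eta *m (transJ c c' x)^T)
}.

Definition vec_tfield (X : vfield) : tfield 1 := fun c u => vec1 (X c u).

Record jacobi_structure (L : tfield 2) (E : vfield) : Prop := JacobiStructure {
  jacobi_bivector : is_multivector L;
  jacobi_vector : is_vector_field E;
  jacobi_LL : forall c u, ctgt c u ->
    @schouten R m 1 1 (L c) (L c) u
      =1 (fun eta => - 2 * wedge (vec_tfield E c u) (L c u) eta);
  jacobi_LE : forall c u, ctgt c u ->
    @schouten R m 1 0 (L c) (vec_tfield E c) u =1 (fun=> 0)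
}.

Definition jacobi_completable (L : tfield 2) : Prop :=
  exists E : vfield, jacobi_structure L E.

Section Conditions.
Variables (p : nat) (w : tfield 2) (tau : 'I_p -> tfield 1).

Definition Lam_field : tfield 2 :=
  fun c u => Lam (w c u) (fun k => tau k c u).

Definition prH_field (c : chart M) (u : 'rV[R]_m) : 'M[R]_m :=
  prH (w c u) (fun k => tau k c u).

Definition horizontal (a : tfield 1) : Prop :=
  forall c u, ctgt c u ->
  forall v : 'rV[R]_m, (v <= Vspace (w c u))%MS -> a c u v = 0.

Variables (abar : tfield 1) (lam : 'I_p -> M -> R).

Definition X_alpha : vfield := fun c u =>
  tBhat_inv (w c u) (fun k => tau k c u) (covec (abar c u))
  - \sum_k lam k (cinv c u) *: Reeb (w c u) (fun k => tau k c u) k.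

Definition cond_i : Prop := forall c u, ctgt c u ->
  pullback (prH_field c u) (dext (w c) u)
    =1 wedge (abar c u) (pullback (prH_field c u) (w c u)).

Definition cond_ii : Prop := forall k c u, ctgt c u ->
  pullback (prH_field c u) (dext (tau k c) u)
    =1 (fun v => lam k (cinv c u) * pullback (prH_field c u) (w c u) v).

Definition cond_iii_tau (k : 'I_p) : Prop := forall c u, ctgt c u ->
  pullback (prH_field c u) (contract (X_alpha c u) (dext (tau k c) u))
    =1 pullback (prH_field c u) (dfun (lam k \o cinv c) u).

Definition cond_iii_w : Prop := forall c u, ctgt c u ->
  pullback (prH_field c u) (lie (X_alpha c) (w c) u) =1 (fun=> 0).

Definition cond_iii_tau_wedge (k : 'I_p) : Prop := forall c u, ctgt c u ->
  wedge (fun v => contract (X_alpha c u) (dext (tau k c) u) v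
                  - dfun (lam k \o cinv c) u v)
        (wedge_all (fun j => tau j c u)) =1 (fun=> 0).

Definition cond_iii_w_wedge : Prop := forall c u, ctgt c u ->
  wedge (lie (X_alpha c) (w c) u) (wedge_all (fun j => tau j c u))
    =1 (fun=> 0).

End Conditions.
End Fields.

Record almost_cosymplectic (R : realType) (n p : nat)
    (M : manifold R (2 * n + p)) (w : tfield M 2) (tau : 'I_p -> tfield M 1) :
    Prop := AlmostCosymplectic {
  cosymp_form2 : is_form w;
  cosymp_form1 : forall k, is_form (tau k);
  cosymp_volume : forall c u, ctgt c u ->
    exists v, wedge (wedge_pow (w c u) n)
                    (wedge_all (fun k => tau k c u)) v != 0;
  cosymp_rank : forall c u, ctgt c u -> wedge_pow (w c u) n.+1 =1 (fun=> 0)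
}.

(* Main.v *)
From mathcomp Require Import all_boot all_order all_algebra all_fingroup.
From mathcomp Require Import all_classical all_reals all_analysis.
From mathcomp Require Import ring.
Require Import Defs.

(** The Jacobi equations are identities between values at a point of tensors
   built from first derivatives, so everything happens in a chart. There, let W
   be the matrix of omega, let T have the coordinates of the tau_k as columns,
   and put B = W + T T^t. Vectors and covectors are rows.

   Algebra at a point. A vector killed by W and by T would make the volume form
   omega^n /\ tau_1 /\ ... /\ tau_p vanish ([top_form_null]), and
   omega^(n+1) = 0 bounds the rank of W by 2n ([wedge_pow_rank]). By dimension,
   Ker W then has a basis dual to the tau_k: these are the R_k. It follows that
   B is invertible and that the matrix L of Lambda satisfies L W = P^t,
   W L = P, L W L = L and L T = 0, where P is the projection onto H along V.
   So the vectors a^# = a L are exactly those of H, and on H the tensors omega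
   and Lambda are inverse to each other up to sign.

   Differentiation. Differentiating L W L = L and L T = 0 along v expresses
   D_v L through D_v W and D_v T ([derive_lam]). Let E be any vector field, and
   put alpha = omega(., E), lambda_k = - tau_k(E). Then
     1/2 [Lambda, Lambda](a, b, c) + (E /\ Lambda)(a, b, c)
       = (d omega - alpha /\ omega)(a^#, b^#, c^#)
         - \sum_k \sum_cyc c(R_k) (d tau_k - lambda_k omega)(a^#, b^#),
   which is [jacobi_LL_defect], and, with mu_k = iota_E d tau_k - d lambda_k,
     [Lambda, E](a, b) = - (Lie_E omega)(a^#, b^#)
         + \sum_k (b(R_k) mu_k(a^#) - a(R_k) mu_k(b^#)),
   which is [jacobi_LE_defect]. Taking tau_k for one of the covectors isolates
   the k-th summand, because tau_k^# = 0 and tau_k(R_j) = delta_jk. Hence each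
   Jacobi equation for E is equivalent to the vanishing on H of all the terms on
   the right ([jacobi_LL_equiv], [jacobi_LE_equiv]), which is what the
   conditions on the exterior derivatives and on the Lie derivative say.

   Completing Lambda. The map from E to (alpha, lambda) is a bijection onto pairs
   of a horizontal form and a p-tuple of functions, with inverse X_alpha
   ([X_alpha_w], [X_alpha_tau], [X_alpha_of]). So looking for E and looking for
   (alpha, lambda) are the same problem.

   Wedge forms of the last conditions. A form is zero on H as soon as its wedge
   product with tau_1 /\ ... /\ tau_p is zero, as one sees by evaluating at
   vectors of H followed by R_1, ..., R_p. Conversely, a 1-form or a 2-form that
   vanishes on H lies in the ideal generated by the tau_k ([wedge_volume1],
   [wedge_volume2]). *)

Set Implicit Arguments.
Unset Strict Implicit.
Unset Printing Implicit Defensive.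

Import Order.TTheory GRing.Theory Num.Theory.
Import numFieldNormedType.Exports.

(** * Wedge products expanded along the first rows *)

Section WedgeProducts.
Local Open Scope ring_scope.
Variables (R : realType) (m : nat).
Implicit Types (k l : nat).

(** For a multilinear form this is the alternation property; unlike the latter it is
   inherited by every wedge product whatever its factors. *)
Definition skew k (a : tensor R m k) : Prop :=
  forall (s : 'S_k) v, a (row_perm s v) = (-1) ^+ s * a v.

(** A permutation of k+1 rows is determined by the row i which it brings first and
   by a permutation of the other ones; its signature is (-1)^i times that of the
   latter. This replaces the associativity of the wedge product below. *)
Lemma alt_sum_expand k (g : tensor R m k.+1) (v : 'M[R]_(k.+1, m)) :
  \sum_(s : 'S_k.+1) (-1) ^+ s * g (row_perm s v) =
  \sum_(i < k.+1) (-1) ^+ i * \sum_(t : 'S_k) (-1) ^+ t *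
    g (col_mx (row i v) (row_perm t (row' i v)) : 'M[R]_(1 + k, m)).
Proof.
rewrite (partition_big (fun s : 'S_k.+1 => s ord0) predT) //=.
apply: eq_bigr => i _.
rewrite (reindex (lift_perm ord0 i)); last first.
  pose f (s : 'S_k.+1) x := odflt x (unlift (s ord0) (s (lift ord0 x))).
  have fK (s : 'S_k.+1) x: lift (s ord0) (f s x) = s (lift ord0 x).
    rewrite /f; have:= neq_lift ord0 x.
    by rewrite -(can_eq (permK s)) => /unlift_some[] ? ? ->.
  have f_inj s : injective (f s).
    move=> x y /(congr1 (lift (s ord0))); rewrite !fK => /perm_inj.
    exact: lift_inj.
  exists (fun s => perm (@f_inj s)) => [s _ | s].
    by apply/permP=> x; rewrite permE /f lift_perm_lift lift_perm_id liftK.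
  move/(s _ =P _) => si0; apply/permP=> x.
  case: (unliftP ord0 x) => [x'|] ->; rewrite ?lift_perm_id //.
  by rewrite lift_perm_lift -si0 permE fK.
rewrite big_distrr /=; apply: eq_big => [t | t _].
  by rewrite lift_perm_id eqxx.
rewrite odd_lift_perm /= mulrA; congr (_ * g _).
  by rewrite -[(-1) ^+ i]signr_odd -signr_addb.
apply/matrixP => a b; rewrite !mxE; case: splitP => [a' | a'] Ea.
  rewrite !mxE; congr (v _ _).
  have -> : a = ord0 by apply: ord_inj; rewrite Ea ord1.
  by rewrite lift_perm_id.
rewrite !mxE; congr (v _ _).
have -> : a = lift ord0 a' by apply: ord_inj; rewrite Ea.
by rewrite lift_perm_lift.
Qed.

Lemma wedge_skew k l (a : tensor R m k) (b : tensor R m l) : skew (wedge a b).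
Proof.
move=> s v; rewrite /wedge mulrCA; congr (_ * _); rewrite big_distrr /=.
rewrite (reindex_inj (mulIg s^-1)%g) /=; apply: eq_bigr => t _.
rewrite -row_permM mulgKV mulrA odd_permM odd_permV signr_addb.
by rewrite -mulrA -mulrA mulrCA.
Qed.

Lemma skew1 (a : tensor R m 1) : skew a.
Proof.
move=> s v; suff -> : s = 1%g by rewrite odd_perm1 expr0 mul1r row_perm1.
by apply/permP=> i; rewrite !ord1.
Qed.

Lemma skew0 (a : tensor R m 0) : skew a.
Proof.
move=> s v; suff -> : s = 1%g by rewrite odd_perm1 expr0 mul1r row_perm1.
by apply/permP=> -[].
Qed.

Lemma alt_sum_skew l (b : tensor R m l) v : skew b ->
  \sum_(t : 'S_l) (-1) ^+ t * b (row_perm t v) = l`!%:R * b v.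
Proof.
move=> bS; rewrite (eq_bigr (fun=> b v)); last first.
  by move=> t _; rewrite bS mulrA -signr_addb addbb mul1r.
by rewrite sumr_const card_Sn mulr_natl.
Qed.

Lemma fact_neq0 l : (l`!%:R : R) != 0.
Proof. by rewrite pnatr_eq0 -lt0n fact_gt0. Qed.

(** The wedge product of a 1-form with a skew form b ([wedge1E]), as a Laplace
   expansion over the row that is given to the 1-form. *)
Definition wedge1 l (a : tensor R m 1) (b : tensor R m l) : tensor R m l.+1 :=
  fun v => \sum_(i < l.+1) (-1) ^+ i * (a (row i v) * b (row' i v)).

Lemma wedge1E l (a : tensor R m 1) (b : tensor R m l) v :
  skew b -> wedge a b v = wedge1 a b v.
Proof.
move=> bS; rewrite /wedge (alt_sum_expand (tprod a b)) big_distrr /=.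
apply: eq_bigr => i _; rewrite mulrCA; congr (_ * _).
transitivity ((1`! * l`!)%:R^-1 *
  (\sum_(t : 'S_l) (-1) ^+ t * b (row_perm t (row' i v)) * a (row i v))).
  congr (_ * _); apply: eq_bigr => t _.
  by rewrite /tprod col_mxKu col_mxKd -mulrA [b _ * _]mulrC.
rewrite -big_distrl /= alt_sum_skew // mul1n mulrA mulrA mulVf ?fact_neq0 //.
by rewrite mul1r mulrC.
Qed.

(** Each unordered pair of rows occurs twice in the double sum, whence the factor 1/2. *)
Lemma wedge2E l (a : tensor R m 2) (b : tensor R m l) v : skew b ->
  wedge a b v = 2%:R^-1 * \sum_(i < l.+2) \sum_(j < l.+1) (-1) ^+ i * ((-1) ^+ j *
    (a (rows2 (row i v) (row j (row' i v))) * b (row' j (row' i v)))).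
Proof.
move=> bS; rewrite /wedge natrM invfM -mulrA; congr (_ * _).
rewrite (alt_sum_expand (tprod a b)) big_distrr /=.
apply: eq_bigr => i _; rewrite mulrCA -big_distrr /=; congr (_ * _).
rewrite (alt_sum_expand (fun z : 'M[R]_(l.+1, m) =>
  tprod a b (col_mx (row i v) z : 'M[R]_(2 + l, m)))) big_distrr /=.
apply: eq_bigr => j _; rewrite mulrCA; congr (_ * _).
transitivity (l`!%:R^-1 *
  (\sum_(t : 'S_l) (-1) ^+ t * b (row_perm t (row' j (row' i v))) *
    a (rows2 (row i v) (row j (row' i v))))).
  congr (_ * _); apply: eq_bigr => t _.
  rewrite -mulrA [b _ * _]mulrC /tprod /rows2; congr (_ * (a _ * b _)).
    apply/matrixP=> x y; rewrite !mxE.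
    case: splitP => x' /= Ex; case: splitP => z /= Ez; rewrite ?mxE.
    - by [].
    - by have := ltn_ord x'; rewrite -Ex Ez.
    - by have := ltn_ord z; rewrite -Ez Ex.
    - case: splitP => z' /= Ez'; rewrite !mxE //.
      by have := ltn_ord x; rewrite Ex Ez'.
  apply/matrixP=> x y; rewrite !mxE.
  case: splitP => z /= Ez; first by have := ltn_ord z; rewrite -Ez.
  rewrite !mxE; case: splitP => z' /= Ez'; rewrite !mxE.
    by move: Ez; rewrite Ez' (ord1 z').
  by congr (v _ _); congr (lift _ (lift _ _)); congr (t _); apply: ord_inj; move: Ez; rewrite Ez' => -[].
by rewrite -big_distrl /= alt_sum_skew // mulrA mulrA mulVf ?fact_neq0 // mul1r mulrC.
Qed.

End WedgeProducts.

(** * Multilinear forms and their null vectors *)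

Section Multilinear.
Local Open Scope ring_scope.
Variables (R : realType) (m : nat).
Implicit Types (k l : nat).

(** Linearity is asked in the two-term form in which [multilinear] provides it. *)
Lemma linear_expand n (f : 'rV[R]_n -> R) (x : 'rV[R]_n) :
  (forall b1 b2 x1 x2, f (b1 *: x1 + b2 *: x2) = b1 * f x1 + b2 * f x2) ->
  f x = \sum_j x 0 j * f (delta_mx 0 j).
Proof.
move=> fL; rewrite {1}[x]row_sum_delta.
have fZ b y : f (b *: y) = b * f y.
  by have := fL b 0 y 0; rewrite scale0r addr0 mul0r addr0.
have fD y z : f (y + z) = f y + f z.
  by have := fL 1 1 y z; rewrite !scale1r !mul1r.
rewrite (big_morph f fD (id1 := 0)) ?(eq_bigr _ (fun j _ => fZ _ _)) //.
by have := fZ 0 0; rewrite scale0r mul0r.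
Qed.

Definition set_row k (v : 'M[R]_(k, m)) (i : 'I_k) (x : 'rV[R]_m) : 'M[R]_(k, m) :=
  \matrix_(j, l) if j == i then x 0 l else v j l.

Lemma row_set_row k (v : 'M[R]_(k, m)) i x : row i (set_row v i x) = x.
Proof. by apply/rowP=> j; rewrite !mxE eqxx. Qed.

Lemma row'_set_row k (v : 'M[R]_(k, m)) i x : row' i (set_row v i x) = row' i v.
Proof. by apply/matrixP=> a b; rewrite !mxE eq_sym (negbTE (neq_lift _ _)). Qed.

Lemma set_row_id k (v : 'M[R]_(k, m)) i : set_row v i (row i v) = v.
Proof. by apply/matrixP=> a b; rewrite !mxE; case: eqP => [->|]. Qed.

Lemma set_row_linear k (a : tensor R m k) (v : 'M[R]_(k, m)) i : multilinear a ->
  forall b1 b2 x1 x2, a (set_row v i (b1 *: x1 + b2 *: x2)) =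
    b1 * a (set_row v i x1) + b2 * a (set_row v i x2).
Proof.
by move=> aM b1 b2 x1 x2; apply: (aM _ _ _ i); rewrite ?row_set_row ?row'_set_row.
Qed.

Lemma set_row_sum k (a : tensor R m k) (v : 'M[R]_(k, m)) i n (c : 'rV[R]_n)
    (A : 'M[R]_(n, m)) : multilinear a ->
  a (set_row v i (c *m A)) = \sum_j c 0 j * a (set_row v i (row j A)).
Proof.
move=> aM; rewrite (linear_expand (f := fun d => a (set_row v i (d *m A)))).
  by apply: eq_bigr => j _; rewrite -rowE.
by move=> b1 b2 x1 x2; rewrite mulmxDl -!scalemxAl; apply: set_row_linear.
Qed.

Lemma row'_eqP k (v1 v2 : 'M[R]_(k, m)) i :
  row' i v1 = row' i v2 <-> forall j, j != i -> row j v1 = row j v2.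
Proof.
split=> [E j | E].
  case: (unliftP i j) => [j'|] ->; last by rewrite eqxx.
  by move=> _; apply/rowP => x; have /matrixP/(_ j' x) := E; rewrite !mxE.
apply/matrixP => a x; rewrite !mxE.
have ai : lift i a != i by rewrite eq_sym neq_lift.
by have /rowP/(_ x) := E _ ai; rewrite !mxE.
Qed.

Lemma tprod_multilinear k l (a : tensor R m k) (b : tensor R m l) :
  multilinear a -> multilinear b -> multilinear (tprod a b).
Proof.
move=> aM bM v v1 v2 i b1 b2 Ei /row'_eqP E1 /row'_eqP E2; rewrite /tprod.
case: (split_ordP i) => i' Ei'; subst i.
  have D v' : (forall j, j != lshift l i' -> row j v' = row j v) ->
      dsubmx v' = dsubmx v.
    by move=> E; apply/row_matrixP=> j; rewrite !row_dsubmx E // eq_rlshift.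
  rewrite (D v1) ?(D v2) // mulrA mulrA -mulrDl; congr (_ * _).
  apply: (aM _ _ _ i'); rewrite ?row_usubmx //; apply/row'_eqP => j ji;
    by rewrite !row_usubmx ?E1 ?E2 // (inj_eq (@lshift_inj _ _)).
have D v' : (forall j, j != rshift k i' -> row j v' = row j v) ->
    usubmx v' = usubmx v.
  by move=> E; apply/row_matrixP=> j; rewrite !row_usubmx E // eq_lrshift.
rewrite (D v1) ?(D v2) // mulrCA (mulrCA b2) -mulrDr; congr (_ * _).
apply: (bM _ _ _ i'); rewrite ?row_dsubmx //; apply/row'_eqP => j ji;
  by rewrite !row_dsubmx ?E1 ?E2 // (inj_eq (@rshift_inj _ _)).
Qed.

Lemma wedge_multilinear k l (a : tensor R m k) (b : tensor R m l) :
  multilinear a -> multilinear b -> multilinear (wedge a b).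
Proof.
move=> aM bM v v1 v2 i b1 b2 Ei /row'_eqP E1 /row'_eqP E2; rewrite /wedge.
rewrite mulrCA (mulrCA b2) -mulrDr; congr (_ * _).
rewrite !big_distrr -big_split /=.
apply: eq_bigr => s _; rewrite (mulrCA b1) (mulrCA b2) -mulrDr; congr (_ * _).
have rs j u : row j (row_perm s u) = row (s j) u.
  by apply/rowP=> x; rewrite !mxE.
apply: (tprod_multilinear aM bM (i := s^-1%g i)); rewrite ?rs ?permKV //.
  by apply/row'_eqP => j ji; rewrite !rs E1 // -(inj_eq (@perm_inj _ s^-1%g)) permK.
by apply/row'_eqP => j ji; rewrite !rs E2 // -(inj_eq (@perm_inj _ s^-1%g)) permK.
Qed.

Lemma wedge_pow_multilinear (w : tensor R m 2) n :
  multilinear w -> multilinear (wedge_pow w n).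
Proof.
move=> wM; elim: n => [v v1 v2 []|n IHn] //; exact: wedge_multilinear.
Qed.

Lemma wedge_all_multilinear p (t : 'I_p -> tensor R m 1) :
  (forall j, multilinear (t j)) -> multilinear (wedge_all t).
Proof.
elim: p t => [t _ v v1 v2 []|p IHp t tM] //.
exact: (wedge_multilinear (tM ord0) (IHp _ (fun j => tM (lift ord0 j)))).
Qed.

(** Exchanging two equal rows changes the sign of the value and not the argument. *)
Lemma skew_eq_rows k (a : tensor R m k) (v : 'M[R]_(k, m)) i j :
  skew a -> i != j -> row i v = row j v -> a v = 0.
Proof.
move=> aS ij E; have := aS (tperm i j) v; rewrite odd_tperm ij expr1 mulN1r.
have -> : row_perm (tperm i j) v = v.
  apply/row_matrixP=> l; have -> : row l (row_perm (tperm i j) v) = row (tperm i j l) v.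
    by apply/rowP=> x; rewrite !mxE.
  by case: tpermP => // ->.
by move/eqP; rewrite -subr_eq0 opprK -mulr2n mulrn_eq0 /= => /eqP.
Qed.

(** For a skew form: x is in the kernel of contraction into the form. *)
Definition null_vector k (a : tensor R m k) (x : 'rV[R]_m) : Prop :=
  forall v i, row i v = x -> a v = 0.

Lemma wedge_null k l (a : tensor R m k) (b : tensor R m l) x :
  null_vector a x -> null_vector b x -> null_vector (wedge a b) x.
Proof.
move=> a0 b0 v i Ei; rewrite /wedge big1 ?mulr0 // => s _; rewrite /tprod.
have : row (s^-1%g i) (row_perm s v) = x.
  by rewrite -Ei; apply/rowP=> y; rewrite !mxE permKV.
case: (split_ordP (s^-1%g i)) => i' ->.
  by rewrite -row_usubmx => /a0 ->; rewrite mul0r mulr0.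
by rewrite -row_dsubmx => /b0 ->; rewrite !mulr0.
Qed.

Lemma wedge_pow_null (w : tensor R m 2) n x :
  null_vector w x -> null_vector (wedge_pow w n) x.
Proof. by move=> w0; elim: n => [v []|n IHn] //; apply: wedge_null. Qed.

Lemma wedge_all_null p (t : 'I_p -> tensor R m 1) x :
  (forall j, null_vector (t j) x) -> null_vector (wedge_all t) x.
Proof.
elim: p t => [t _ v []|p IHp t t0] //.
exact: (wedge_null (t0 ord0) (IHp _ (fun j => t0 (lift ord0 j)))).
Qed.

(** If c_i is nonzero, replacing row i by the combination of the rows with
   coefficients c multiplies the value by c_i, since the other terms have two equal
   rows. *)
Lemma null_vector_comb k (a : tensor R m k) (v : 'M[R]_(k, m)) (c : 'rV[R]_k) :
  multilinear a -> skew a -> c != 0 -> null_vector a (c *m v) -> a v = 0.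
Proof.
move=> aM aS c0 a0; have [i ci] : exists i, c 0 i != 0.
  apply/existsP; apply: contraNT c0 => /existsPn c0.
  by apply/eqP/rowP=> i; rewrite mxE; apply/eqP; have := c0 i; rewrite negbK.
have := a0 (set_row v i (c *m v)) i (row_set_row _ _ _); rewrite set_row_sum //.
rewrite (bigD1 i) //= set_row_id big1 ?addr0 => [/eqP|j ji].
  by rewrite mulf_eq0 (negbTE ci) => /eqP.
rewrite (skew_eq_rows (i := i) (j := j)) ?mulr0 //; first by rewrite eq_sym.
rewrite row_set_row; apply/rowP=> x; by rewrite !mxE (negbTE ji).
Qed.

(** In top degree, either the rows of v are linearly dependent or x is a combination
   of them; so some nontrivial combination of the rows is a null vector. *)
Lemma top_form_null k (a : tensor R m k) (v : 'M[R]_(k, m)) x : k = m ->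
  multilinear a -> skew a -> null_vector a x -> null_vector a 0 ->
  x != 0 -> a v = 0.
Proof.
move=> Ek aM aS ax a0 x0; case: (boolP (row_free v)) => [vf | ].
  have /submxP[c Ec] : (x <= v)%MS.
    by rewrite (submx_trans (submx1 x)) // sub1mx /row_full -{2}Ek.
  apply: (null_vector_comb aM aS (c := c)); last by rewrite -Ec.
  by apply: contraNneq x0 => c0; rewrite Ec c0 mul0mx.
rewrite -kermx_eq0 => /rowV0Pn[c /sub_kermxP Ec c0].
by apply: (null_vector_comb aM aS c0); rewrite Ec.
Qed.

Lemma multilinear_null0 k (a : tensor R m k) : multilinear a -> null_vector a 0.
Proof.
move=> aM v i Ei; rewrite -[v](set_row_id _ i) Ei.
have := set_row_linear v i aM 0 0 0 0.
by rewrite !scale0r addr0 !mul0r addr0.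
Qed.

Lemma rows2K (v : 'M[R]_(1 + 1, m)) :
  rows2 (row ord0 v) (row (lift ord0 ord0) v) = v.
Proof.
apply/row_matrixP=> i; rewrite /rows2; apply/rowP => x; rewrite !mxE.
case: splitP => j /= Ej; rewrite !mxE; congr (v _ _); apply: ord_inj;
  by rewrite Ej (ord1 j).
Qed.

Lemma row_rows2_0 (x y : 'rV[R]_m) : row ord0 (rows2 x y) = x.
Proof.
by apply/rowP=> j; rewrite !mxE; case: splitP => // i _; rewrite (ord1 i).
Qed.

Lemma row_rows2_1 (x y : 'rV[R]_m) : row (lift ord0 ord0) (rows2 x y) = y.
Proof.
apply/rowP=> j; rewrite !mxE; case: splitP => i /= Ei; last by rewrite (ord1 i).
by have := ltn_ord i; rewrite -Ei.
Qed.

Lemma set_row_rows2_0 (x y z : 'rV[R]_m) : set_row (rows2 x y) ord0 z = rows2 z y.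
Proof.
by rewrite -[LHS]rows2K row_set_row; congr rows2;
  rewrite -[RHS](row_rows2_1 x y); apply/rowP=> j; rewrite !mxE.
Qed.

Lemma set_row_rows2_1 (x y z : 'rV[R]_m) :
  set_row (rows2 x y) (lift ord0 ord0) z = rows2 x z.
Proof.
by rewrite -[LHS]rows2K row_set_row; congr rows2;
  rewrite -[RHS](row_rows2_0 x y); apply/rowP=> j; rewrite !mxE.
Qed.

Lemma tensor1E (a : tensor R m 1) (v : 'rV[R]_m) :
  multilinear a -> a v = (v *m (covec a)^T) 0 0.
Proof.
move=> aM; rewrite mxE (linear_expand (f := a)) => [|b1 b2 x1 x2].
  by apply: eq_bigr => j _; rewrite !mxE.
have E x : set_row 0 0 x = x by apply/rowP=> j; rewrite !mxE eqxx.
by have := set_row_linear 0 0 aM b1 b2 x1 x2; rewrite !E.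
Qed.

Lemma rows2_linearl (a : tensor R m 2) (y : 'rV[R]_m) : multilinear a ->
  forall b1 b2 x1 x2, a (rows2 (b1 *: x1 + b2 *: x2) y) =
    b1 * a (rows2 x1 y) + b2 * a (rows2 x2 y).
Proof.
move=> aM b1 b2 x1 x2; have := set_row_linear (rows2 0 y) ord0 aM b1 b2 x1 x2.
by rewrite !set_row_rows2_0.
Qed.

Lemma rows2_linearr (a : tensor R m 2) (x : 'rV[R]_m) : multilinear a ->
  forall b1 b2 y1 y2, a (rows2 x (b1 *: y1 + b2 *: y2)) =
    b1 * a (rows2 x y1) + b2 * a (rows2 x y2).
Proof.
move=> aM b1 b2 y1 y2.
have := set_row_linear (rows2 x 0) (lift ord0 ord0) aM b1 b2 y1 y2.
by rewrite !set_row_rows2_1.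
Qed.

Lemma tensor2E (a : tensor R m 2) (x y : 'rV[R]_m) :
  multilinear a -> a (rows2 x y) = (x *m hat a *m y^T) 0 0.
Proof.
move=> aM; rewrite (linear_expand (f := fun x => a (rows2 x y))); last first.
  exact: rows2_linearl.
rewrite -mulmxA mxE; apply: eq_bigr => i _; congr (_ * _); rewrite mxE.
rewrite (linear_expand (f := fun y => a (rows2 _ y))); last first.
  exact: rows2_linearr.
by apply: eq_bigr => j _; rewrite !mxE mulrC.
Qed.

Lemma alternating_hat (a : tensor R m 2) :
  multilinear a -> alternating a -> (hat a)^T = - hat a.
Proof.
move=> aM aA; have a0 z : a (rows2 z z) = 0.
  apply: (aA _ ord0 (lift ord0 ord0)) => //.
  by rewrite row_rows2_0 row_rows2_1.
apply/matrixP=> i j; rewrite !mxE; set x := delta_mx 0 i; set y := delta_mx 0 j.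
have := a0 (1 *: x + 1 *: y).
rewrite (rows2_linearl _ aM) !(rows2_linearr _ aM) !a0 !mul1r add0r addr0.
by rewrite addrC => /eqP; rewrite addr_eq0 => /eqP.
Qed.

(** The symmetric group on two letters has no other elements than 1 and the
   transposition. *)
Lemma skew2 (a : tensor R m 2) :
  (forall x y, a (rows2 y x) = - a (rows2 x y)) -> skew a.
Proof.
move=> aS s v; have rs j : row j (row_perm s v) = row (s j) v.
  by apply/rowP=> x; rewrite !mxE.
rewrite -[row_perm s v]rows2K !rs -{3}[v]rows2K.
have two (i : 'I_2) : i = ord0 \/ i = lift ord0 ord0.
  by case: i => [[|[|i]] Hi] //; [left|right]; apply: ord_inj.
have [s0|s0] := two (s ord0); have [s1|s1] := two (s (lift ord0 ord0)).
- by have /perm_inj : s ord0 = s (lift ord0 ord0) by rewrite s0 s1.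
- have -> : s = 1%g.
    by apply/permP=> i; rewrite perm1; have [->|->] := two i.
  by rewrite odd_perm1 !perm1 mul1r.
- have -> : s = tperm ord0 (lift ord0 ord0).
    by apply/permP=> i; have [->|->] := two i; rewrite ?tpermL ?tpermR.
  by rewrite odd_tperm tpermL tpermR expr1 mulN1r aS.
- by have /perm_inj : s ord0 = s (lift ord0 ord0) by rewrite s0 s1.
Qed.

End Multilinear.

(** * Wedge products by 1-forms, and the rank of a 2-form *)

Section WedgeByOneForms.
Local Open Scope ring_scope.
Variables (R : realType) (m : nat).
Implicit Types (k l : nat).

Lemma wedge_suml I (r : seq I) k l (a : I -> tensor R m k) (b : tensor R m l) v :
  wedge (fun z => \sum_(i <- r) a i z) b v = \sum_(i <- r) wedge (a i) b v.
Proof.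
rewrite /wedge -big_distrr /=; congr (_ * _).
rewrite exchange_big /=; apply: eq_bigr => s _.
by rewrite /tprod big_distrl big_distrr.
Qed.

Lemma wedge1_eqr l (a : tensor R m 1) (b b' : tensor R m l) v :
  b =1 b' -> wedge1 a b v = wedge1 a b' v.
Proof. by move=> E; apply: eq_bigr => i _; rewrite E. Qed.

Lemma wedge1_scaler l c (a : tensor R m 1) (b : tensor R m l) v :
  wedge1 a (fun z => c * b z) v = c * wedge1 a b v.
Proof.
rewrite /wedge1 big_distrr; apply: eq_bigr => i _ /=.
by rewrite (mulrCA c); congr (_ * _); rewrite mulrCA.
Qed.

Lemma wedge1_subr l (a : tensor R m 1) (b b' : tensor R m l) v :
  wedge1 a (fun z => b z - b' z) v = wedge1 a b v - wedge1 a b' v.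
Proof.
rewrite /wedge1 -sumrB; apply: eq_bigr => i _.
by rewrite !mulrBr.
Qed.

Lemma wedge1_suml I (r : seq I) l (c : I -> R) (a : I -> tensor R m 1)
    (b : tensor R m l) v :
  wedge1 (fun z => \sum_(i <- r) c i * a i z) b v =
  \sum_(i <- r) c i * wedge1 (a i) b v.
Proof.
rewrite /wedge1 (eq_bigr _ (fun i _ => big_distrr _ _ _)) exchange_big /=.
apply: eq_bigr => j _; rewrite big_distrl big_distrr /=; apply: eq_bigr => i _.
by rewrite -mulrA mulrCA.
Qed.

Lemma wedge1_sumr I (r : seq I) l (a : tensor R m 1) (b : I -> tensor R m l) v :
  wedge1 a (fun z => \sum_(i <- r) b i z) v = \sum_(i <- r) wedge1 a (b i) v.
Proof.
rewrite /wedge1 exchange_big /=; apply: eq_bigr => j _.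
by rewrite big_distrr big_distrr.
Qed.

Lemma wedge_tprodE l (a b : tensor R m 1) (c : tensor R m l) v : skew c ->
  wedge (tprod a b) c v = 2%:R^-1 * wedge1 a (wedge1 b c) v.
Proof.
move=> cS; rewrite wedge2E //; congr (_ * _); apply: eq_bigr => i _.
rewrite !big_distrr /=; apply: eq_bigr => j _; congr (_ * _).
by rewrite /tprod /rows2 col_mxKu col_mxKd !mulrA; congr (_ * _ * _); rewrite mulrC.
Qed.

(** The transposition of the first two rows exchanges the roles of the two 1-forms. *)
Lemma wedge_tprodC l (a b : tensor R m 1) (c : tensor R m l) v :
  wedge (tprod a b) c v = - wedge (tprod b a) c v.
Proof.
rewrite /wedge -mulrN -sumrN; congr (_ * _).
pose t : 'S_(1 + 1 + l) := tperm (lshift l ord0) (lshift l (lift ord0 ord0)).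
rewrite (reindex_inj (mulgI t)) /=; apply: eq_bigr => s _.
have tO : t = true :> bool by rewrite odd_tperm.
rewrite odd_permM tO signrN mulNr.
congr (- (_ * _)); rewrite row_permM /tprod.
have -> : usubmx (usubmx (row_perm t (row_perm s v))) =
          dsubmx (usubmx (row_perm s v)) :> 'M[R]_(1, m).
  apply/matrixP=> i j; rewrite !mxE; congr (v (s _) _).
  have -> : lshift l (lshift 1 i) = lshift l ord0 :> 'I_(1 + 1 + l).
    by apply: ord_inj; rewrite (ord1 i).
  by rewrite tpermL; apply: ord_inj; rewrite (ord1 i).
have -> : dsubmx (usubmx (row_perm t (row_perm s v))) =
          usubmx (usubmx (row_perm s v)) :> 'M[R]_(1, m).
  apply/matrixP=> i j; rewrite !mxE; congr (v (s _) _).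
  have -> : lshift l (rshift 1 i) = lshift l (lift ord0 ord0) :> 'I_(1 + 1 + l).
    by apply: ord_inj; rewrite (ord1 i).
  by rewrite tpermR; apply: ord_inj; rewrite (ord1 i).
have -> : dsubmx (row_perm t (row_perm s v)) = dsubmx (row_perm s v) :> 'M[R]_(l, m).
  by apply/matrixP=> i j; rewrite !mxE tpermD // eq_lrshift.
by rewrite [a _ * b _]mulrC.
Qed.

Lemma wedge1C l (a b : tensor R m 1) (c : tensor R m l) v : skew c ->
  wedge1 a (wedge1 b c) v = - wedge1 b (wedge1 a c) v.
Proof.
move=> cS; have := wedge_tprodC a b c v; rewrite !wedge_tprodE // -mulrN.
by apply: mulfI; rewrite invr_eq0 pnatr_eq0.
Qed.

Lemma wedge1_skew l (a : tensor R m 1) (b : tensor R m l) :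
  skew b -> skew (wedge1 a b).
Proof. by move=> bS s v; rewrite -!wedge1E //; apply: wedge_skew. Qed.

Lemma contract_skew l (b : tensor R m l.+1) x :
  skew b -> skew (@contract R m l x b).
Proof.
move=> bS s v; rewrite /contract.
have := bS (lift_perm ord0 ord0 s) (col_mx x v).
rewrite odd_lift_perm /= => <-; congr b.
apply/matrixP=> i j; case: (unliftP ord0 i) => [i'|] ->; rewrite !mxE.
  rewrite lift_perm_lift; case: splitP => z /= Ez.
    by have := ltn_ord z; rewrite -Ez.
  case: splitP => y /= Ey; first by have := ltn_ord y; rewrite -Ey.
  rewrite mxE; congr (v _ _); apply: ord_inj.
  have -> : z = i' by apply: ord_inj; case: Ez.
  by case: Ey.
rewrite lift_perm_id; by case: splitP.
Qed.

Lemma row'0_col_mx l (x : 'rV[R]_m) (v : 'M[R]_(l, m)) :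
  row' ord0 (col_mx x v : 'M[R]_(1 + l, m)) = v.
Proof.
apply/matrixP=> a j; rewrite !mxE; case: splitP => z /= Ez.
  by have := ltn_ord z; rewrite -Ez.
by congr (v _ _); apply: ord_inj; case: Ez.
Qed.

Lemma row0_col_mx l (x : 'rV[R]_m) (v : 'M[R]_(l, m)) :
  row ord0 (col_mx x v : 'M[R]_(1 + l, m)) = x.
Proof.
by apply/rowP=> j; rewrite !mxE; case: splitP => // z _; rewrite (ord1 z).
Qed.

Lemma row_lift0_col_mx l (x : 'rV[R]_m) (v : 'M[R]_(l, m)) i :
  row (lift ord0 i) (col_mx x v : 'M[R]_(1 + l, m)) = row i v.
Proof.
apply/rowP=> j; rewrite !mxE; case: splitP => z /= Ez.
  by have := ltn_ord z; rewrite -Ez.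
by congr (v _ _); apply: ord_inj; case: Ez.
Qed.

Lemma row_row' k (v : 'M[R]_(k.+1, m)) i j : row j (row' i v) = row (lift i j) v.
Proof. by apply/rowP=> x; rewrite !mxE. Qed.

Lemma lift_lift0 k (i : 'I_k.+1) : lift (lift ord0 i) ord0 = ord0.
Proof. exact: ord_inj. Qed.

Lemma lift_lift_lift0 k (i : 'I_k.+1) (j : 'I_k) :
  lift (lift ord0 i) (lift ord0 j) = lift ord0 (lift i j).
Proof. by apply: ord_inj; rewrite /= /bump !add1n ltnS addnS. Qed.

Lemma row'_lift0_col_mx l (x : 'rV[R]_m) (v : 'M[R]_(l.+1, m)) i :
  row' (lift ord0 i) (col_mx x v : 'M[R]_(1 + l.+1, m)) =
  col_mx x (row' i v) :> 'M[R]_(1 + l, m).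
Proof.
apply/row_matrixP => a; rewrite row_row'.
case: (unliftP ord0 a) => [a'|] ->; last by rewrite lift_lift0 !row0_col_mx.
by rewrite lift_lift_lift0 !row_lift0_col_mx row_row'.
Qed.

Lemma wedge1_cons l (a : tensor R m 1) (b : tensor R m l) x (v : 'M[R]_(l, m)) :
  wedge1 a b (col_mx x v : 'M[R]_(1 + l, m)) = a x * b v -
  \sum_(i < l) (-1) ^+ i *
    (a (row i v) * b (row' (lift ord0 i) (col_mx x v : 'M[R]_(1 + l, m)))).
Proof.
rewrite /wedge1 big_ord_recl row0_col_mx row'0_col_mx /= mul1r -sumrN.
by congr (_ + _); apply: eq_bigr => i _; rewrite row_lift0_col_mx exprS mulN1r mulNr.
Qed.

(** Contraction by x is an antiderivation. *)
Lemma contract_wedge1 l (a : tensor R m 1) (b : tensor R m l.+1) x v :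
  @contract R m l.+1 x (wedge1 a b) v =
  a x * b v - wedge1 a (@contract R m l x b) v.
Proof.
rewrite /contract wedge1_cons; congr (_ - _).
by apply: eq_bigr => i _; rewrite row'_lift0_col_mx.
Qed.

(** A 2-form is half the sum of the e^j /\ w(e_j, .), so that wedging by it reduces
   to wedging by 1-forms. *)
Lemma wedge_tensor2 l (w : tensor R m 2) (b : tensor R m l) v :
  multilinear w -> skew b ->
  wedge w b v = 2%:R^-1 * \sum_j wedge1 (fun x => x 0 j)
    (wedge1 (fun y => w (rows2 (delta_mx 0 j) y)) b) v.
Proof.
move=> wM bS; rewrite big_distrr /=.
rewrite (eq_bigr _ (fun j _ => esym (wedge_tprodE _ _ _ bS))) -wedge_suml.
rewrite /wedge; congr (_ * _); apply: eq_bigr => s _; congr (_ * _).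
rewrite {1}/tprod; congr (_ * _); set z := usubmx _; rewrite -[z]rows2K.
rewrite (linear_expand (f := fun x => w (rows2 x _))); last exact: rows2_linearl.
by apply: eq_bigr => j _; rewrite /tprod /rows2 col_mxKu col_mxKd.
Qed.

(** The antiderivation property of contraction, for a 2-form: the two 1-form factors
   of [wedge_tensor2] contribute the same term, which cancels the factor 1/2. *)
Lemma contract_wedge2 l (w : tensor R m 2) (b : tensor R m l.+1) x v :
  multilinear w -> (forall x y, w (rows2 y x) = - w (rows2 x y)) -> skew b ->
  @contract R m l.+2 x (wedge w b) v =
  wedge1 (fun y => w (rows2 x y)) b v + wedge w (@contract R m l x b) v.
Proof.
move=> wM wS bS; rewrite {1}/contract !wedge_tensor2 //; last exact: contract_skew.
set e := fun j : 'I_m => (fun y : 'rV[R]_m => y 0 j).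
set wj := fun j => (fun y => w (rows2 (delta_mx 0 j) y)).
transitivity (2%:R^-1 * \sum_j ((x 0 j * wedge1 (wj j) b v -
   wj j x * wedge1 (e j) b v) +
   wedge1 (e j) (wedge1 (wj j) (@contract R m l x b)) v)).
  congr (_ * _); apply: eq_bigr => j _.
  rewrite [LHS](contract_wedge1 (e j) (wedge1 (wj j) b)) -addrA; congr (_ + _).
  rewrite (wedge1_eqr _ _ (contract_wedge1 (wj j) b x)) wedge1_subr.
  by rewrite wedge1_scaler opprB addrC.
rewrite big_split /= mulrDr; congr (_ + _); rewrite sumrB -!wedge1_suml.
have -> : (fun z => \sum_j x 0 j * wj j z) = (fun y => w (rows2 x y)).
  apply/funext => y; rewrite [RHS](linear_expand (f := fun x => w (rows2 x y))) //.
  exact: rows2_linearl.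
have -> : (fun z => \sum_j wj j x * e j z) = (fun y => -1 * w (rows2 x y)).
  apply/funext => y; rewrite mulN1r -wS.
  rewrite [RHS](linear_expand (f := fun z => w (rows2 z x))).
    by apply: eq_bigr => j _; rewrite mulrC.
  exact: rows2_linearl.
have -> : wedge1 (fun y => -1 * w (rows2 x y)) b v =
          - wedge1 (fun y => w (rows2 x y)) b v.
  rewrite /wedge1 -sumrN; apply: eq_bigr => i _.
  by rewrite mulN1r mulNr mulrN.
by rewrite opprK -mulr2n -[X in _ * X]mulr_natl mulKf // pnatr_eq0.
Qed.

Lemma wedge2_0 (w : tensor R m 2) (b : tensor R m 0) v :
  (forall x y, w (rows2 y x) = - w (rows2 x y)) -> wedge w b v = w v * b 0.
Proof.
move=> wS; rewrite wedge2E; last exact: skew0.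
rewrite !big_ord_recl !big_ord0 /= !addr0 ?mul1r.
have b0 (z : 'M[R]_(0, m)) : b z = b 0 by congr b; apply: flatmx0.
rewrite !b0; set x := row _ (row' _ v); set y := row _ (row' _ v).
have -> : x = row (lift ord0 ord0) v.
  by apply/rowP=> j; rewrite !mxE; congr (v _ _); apply: ord_inj.
have -> : y = row ord0 v.
  by apply/rowP=> j; rewrite !mxE; congr (v _ _); apply: ord_inj.
rewrite (wS (row ord0 v)) rows2K /bump /= expr1 mulN1r mulNr opprK -mulr2n.
by rewrite -[X in _ * X]mulr_natl mulKf // pnatr_eq0.
Qed.

Lemma wedge_pow_skew (w : tensor R m 2) n : skew (wedge_pow w n).
Proof. by case: n => [|n]; [exact: skew0 | exact: wedge_skew]. Qed.

(** The derivative of a power. The induction step moves the 1-form w(x, .) through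
   w, that is, through two 1-forms ([wedge1C]). *)
Lemma contract_wedge_pow (w : tensor R m 2) n x v :
  multilinear w -> (forall x y, w (rows2 y x) = - w (rows2 x y)) ->
  @contract R m (n * 2).+1 x (wedge_pow w n.+1) v =
  n.+1%:R * wedge1 (fun y => w (rows2 x y)) (wedge_pow w n) v.
Proof.
move=> wM wS; elim: n v => [v|n IHn v].
  rewrite /contract /= (wedge2_0 _ (col_mx x v) wS) /wedge1 big_ord1 !mulr1 expr0 !mul1r.
  by congr (w (rows2 _ _)); apply/rowP=> j; rewrite !mxE.
have wS1 : @skew R m (n * 2).+2 (wedge_pow w n.+1) := @wedge_pow_skew w n.+1.
rewrite [LHS](@contract_wedge2 (n * 2).+1 w (wedge_pow w n.+1) x v wM wS wS1).
rewrite -[n.+2]addn1 natrD mulrDl mul1r addrC; congr (_ + _).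
set a := fun y => w (rows2 x y).
have -> : @contract R m (n * 2).+1 x (wedge_pow w n.+1) =
  (fun z => n.+1%:R * wedge1 a (wedge_pow w n) z) by apply/funext.
have aS := wedge1_skew a (wedge_pow_skew w (n := n)).
rewrite wedge_tensor2 //; last by move=> s z; rewrite aS mulrCA.
rewrite [X in _ = _ * X](_ : _ = 2%:R^-1 * \sum_j wedge1 (fun x => x 0 j)
    (wedge1 (fun y => w (rows2 (delta_mx 0 j) y)) (wedge1 a (wedge_pow w n))) v).
  rewrite mulrCA; congr (_ * _); rewrite big_distrr; apply: eq_bigr => j _ /=.
  rewrite -wedge1_scaler; apply: wedge1_eqr => z; exact: wedge1_scaler.
have wpS := @wedge_pow_skew w n.
rewrite (wedge1_eqr _ _ (fun z => wedge_tensor2 z wM wpS)) wedge1_scaler.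
congr (_ * _); rewrite wedge1_sumr; apply: eq_bigr => j _.
rewrite [LHS]wedge1C; last exact: wedge1_skew.
rewrite (wedge1_eqr _ _ (fun z => wedge1C _ _ z wpS)).
rewrite (_ : (fun z => - _) = (fun z => -1 * wedge1
    (fun y => w (rows2 (delta_mx 0 j) y)) (wedge1 a (wedge_pow w n)) z)).
  by rewrite wedge1_scaler mulN1r opprK.
by apply/funext => z; rewrite mulN1r.
Qed.

(** Contracting w^(n+1) = 0 by x and then by y, and evaluating at u, yields
   w(x, y) w^n(u) as a combination of the w(x, u_j) whose coefficients depend on y only.
   So the matrix of w factors through the space of dimension 2n of the index j. *)
Lemma wedge_pow_rank (w : tensor R m 2) n u :
  multilinear w -> (forall x y, w (rows2 y x) = - w (rows2 x y)) ->
  wedge_pow w n.+1 =1 (fun=> 0) -> wedge_pow w n u != 0 ->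
  (\rank (hat w) <= n * 2)%N.
Proof.
move=> wM wS w0 wu.
pose X : 'M[R]_(m, n * 2) := \matrix_(i, j) w (rows2 (delta_mx 0 i) (row j u)).
pose Y : 'M[R]_(n * 2, m) := \matrix_(j, b) ((-1) ^+ j * (wedge_pow w n u)^-1 *
  wedge_pow w n (row' (lift ord0 j) (col_mx (delta_mx 0 b) u : 'M[R]_(1 + n * 2, m)))).
have -> : hat w = X *m Y.
  apply/matrixP=> i b; rewrite !mxE.
  have := @contract_wedge_pow w n (delta_mx 0 i)
    (col_mx (delta_mx 0 b) u : 'M[R]_(1 + n * 2, m)) wM wS.
  rewrite {1}/contract w0 => /esym/eqP; rewrite mulf_eq0 pnatr_eq0 /=.
  rewrite wedge1_cons subr_eq0 => /eqP E; apply: (mulIf wu); rewrite E big_distrl /=.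
  apply: eq_bigr => j _; rewrite !mxE; set W := wedge_pow w n u in wu *.
  by rewrite -!mulrA mulrCA; congr (_ * (_ * _)); rewrite mulrCA mulVf ?mulr1.
by rewrite (leq_trans (mxrankM_maxl _ _)) // rank_leq_col.
Qed.

Lemma wedge_all_skew p (t : 'I_p -> tensor R m 1) : skew (wedge_all t).
Proof.
case: p t => [|q] t; first exact: skew0.
exact: (wedge_skew (t ord0) (wedge_all (fun i => t (lift ord0 i)))).
Qed.

(** Both sides have the same Laplace expansion along the first form. *)
Lemma wedge_all_det p (t : 'I_p -> tensor R m 1) v :
  (forall j, multilinear (t j)) ->
  wedge_all t v = \det (\matrix_(i, j) t j (row i v)).
Proof.
elim: p t v => [|p IHp] t v tM; first by rewrite det_mx00.
rewrite [LHS](@wedge1E _ _ _ _ (wedge_all (fun i => t (lift ord0 i)))); last first.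
  exact: wedge_all_skew.
rewrite (expand_det_col _ ord0); apply: eq_bigr => i _.
rewrite mxE /cofactor addn0 mulrCA; congr (_ * (_ * _)).
rewrite IHp //; congr (\det _); apply/matrixP=> a b.
by rewrite !mxE row_row'.
Qed.

End WedgeByOneForms.

(** * Linear algebra of an almost cosymplectic structure *)

Section CosymplecticMatrices.
Local Open Scope ring_scope.
Variables (F : fieldType) (m p : nat).
Implicit Types (W : 'M[F]_m) (T : 'M[F]_(m, p)).

Definition Bmx W T := W + T *m T^T.
(** The rows are the vectors R_k. *)
Definition reeb_mx W T : 'M[F]_(p, m) := T^T *m invmx (Bmx W T).
Definition proj_H W T : 'M[F]_m := 1%:M - T *m reeb_mx W T.
(** The matrix of the bivector field Lambda = - (Lambda^2 B^-1)(omega). *)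
Definition lam_mx W T : 'M[F]_m := - (invmx (Bmx W T) *m W *m (invmx (Bmx W T))^T).

(** What the linear algebra needs from the volume and rank conditions. *)
Record nondegenerate W T : Prop := Nondegenerate {
  nondeg_skew : W^T = - W;
  nondeg_ker : forall x : 'rV[F]_m, x *m W = 0 -> x *m T = 0 -> x = 0;
  nondeg_rank : (\rank W + p <= m)%N
}.

Variables (W : 'M[F]_m) (T : 'M[F]_(m, p)).
Hypothesis WT : nondegenerate W T.
Local Notation B := (Bmx W T).
Local Notation Rm := (reeb_mx W T).
Local Notation P := (proj_H W T).
Local Notation L := (lam_mx W T).

(** T is injective on Ker W, whose dimension is at least p, and takes its values in
   dimension p; so it maps Ker W onto the whole space. *)
Lemma dual_frame_exists : exists2 Q : 'M[F]_(p, m), Q *m W = 0 & Q *m T = 1%:M.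
Proof.
have KT0 : (kermx W :&: kermx T)%MS = 0.
  apply/eqP/rowV0P => x; rewrite sub_capmx => /andP[/sub_kermxP xW /sub_kermxP xT].
  exact: (nondeg_ker WT xW xT).
have : row_full (kermx W *m T).
  rewrite -col_leq_rank; have := mxrank_mul_ker (kermx W) T.
  rewrite KT0 mxrank0 addn0 => ->; rewrite mxrank_ker.
  by rewrite leq_subRL ?rank_leq_row // (nondeg_rank WT).
by case/row_fullP => D HD; exists (D *m kermx W); rewrite -mulmxA ?mulmx_ker ?mulmx0.
Qed.

(** Applying B to x and pairing with the dual frame of Ker W recovers x T, and then x W. *)
Lemma Bmx_unit : B \in unitmx.
Proof.
have [Q QW QT] := dual_frame_exists.
have WQ : W *m Q^T = 0.
  by rewrite -[W]trmxK -trmx_mul (nondeg_skew WT) mulmxN QW oppr0 trmx0.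
rewrite -row_free_unit -kermx_eq0; apply/rowV0P => x /sub_kermxP.
rewrite mulmxDr mulmxA => xB.
have xT : x *m T = 0.
  have := congr1 (mulmx^~ Q^T) xB.
  by rewrite mulmxDl -mulmxA WQ mulmx0 add0r -mulmxA -trmx_mul QT trmx1 mulmx1 mul0mx.
apply: (nondeg_ker WT _ xT).
by move: xB; rewrite xT mul0mx addr0.
Qed.

(** The dual frame Q satisfies Q B = T^t, so it is unique. *)
Lemma reeb_dual : Rm *m W = 0 /\ Rm *m T = 1%:M.
Proof.
have [Q QW QT] := dual_frame_exists.
suff -> : Rm = Q by [].
have QB : Q *m B = T^T by rewrite mulmxDr QW add0r mulmxA QT mul1mx.
by rewrite /reeb_mx -QB mulmxK // Bmx_unit.
Qed.

Lemma reeb_W : Rm *m W = 0. Proof. by case: reeb_dual. Qed.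
Lemma reeb_T : Rm *m T = 1%:M. Proof. by case: reeb_dual. Qed.

Lemma W_reeb : W *m Rm^T = 0.
Proof.
by apply: trmx_inj; rewrite trmx_mul trmxK (nondeg_skew WT) mulmxN reeb_W oppr0 trmx0.
Qed.

Lemma tr_T_reeb : T^T *m Rm^T = 1%:M.
Proof. by rewrite -trmx_mul reeb_T trmx1. Qed.

Lemma invB_T : invmx B *m T = Rm^T.
Proof.
have : B *m Rm^T = T by rewrite mulmxDl W_reeb add0r -mulmxA tr_T_reeb mulmx1.
by move/(congr1 (mulmx (invmx B))); rewrite mulKmx ?Bmx_unit.
Qed.

Lemma tr_proj_H : P^T = 1%:M - Rm^T *m T^T.
Proof. by rewrite raddfB /= trmx1 trmx_mul. Qed.

Lemma invB_W : invmx B *m W = P^T.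
Proof.
have E : B - T *m T^T = W by rewrite /Bmx addrK.
rewrite -[X in _ *m X = _]E.
by rewrite mulmxBr mulVmx ?Bmx_unit // mulmxA invB_T tr_proj_H.
Qed.

Lemma W_invB : W *m invmx B = P.
Proof.
have E : B - T *m T^T = W by rewrite /Bmx addrK.
rewrite -[X in X *m _ = _]E.
by rewrite mulmxBl mulmxV ?Bmx_unit // -mulmxA.
Qed.

Lemma lam_skew : L^T = - L.
Proof.
rewrite /lam_mx raddfN /= !trmx_mul trmxK (nondeg_skew WT) mulNmx mulmxN.
by rewrite mulmxA.
Qed.

Lemma proj_T : P *m T = 0.
Proof. by rewrite mulmxBl mul1mx -mulmxA reeb_T mulmx1 subrr. Qed.

Lemma proj_W : P *m W = W.
Proof. by rewrite mulmxBl mul1mx -mulmxA reeb_W mulmx0 subr0. Qed.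

(** Lambda inverts omega on the horizontal space. *)
Lemma W_lam : W *m L = P.
Proof.
rewrite /lam_mx mulmxN !mulmxA W_invB proj_W.
have -> : W *m (invmx B)^T = - (P^T)^T.
  by rewrite -invB_W trmx_mul (nondeg_skew WT) mulNmx opprK.
by rewrite opprK trmxK.
Qed.

Lemma lam_W : L *m W = P^T.
Proof.
by rewrite -W_lam trmx_mul lam_skew (nondeg_skew WT) mulNmx mulmxN opprK.
Qed.

Lemma lam_T : L *m T = 0.
Proof.
rewrite /lam_mx mulNmx invB_W -!mulmxA.
have -> : (invmx B)^T *m T = Rm^T.
  by rewrite /reeb_mx trmx_mul trmxK.
by rewrite tr_proj_H mulmxBl mul1mx -mulmxA tr_T_reeb mulmx1 subrr oppr0.
Qed.

Lemma lam_proj : L *m P = L.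
Proof. by rewrite mulmxBr mulmx1 mulmxA lam_T mul0mx subr0. Qed.

Lemma lam_W_lam : L *m W *m L = L.
Proof. by rewrite -mulmxA W_lam lam_proj. Qed.

(** Since x = x P + (x T) R, with x P in Ker T and R in Ker W. *)
Lemma proj_mx_kernels : proj_mx (kermx T) (kermx W) = P.
Proof.
have KT0 : (kermx T :&: kermx W)%MS = 0.
  apply/eqP/rowV0P => x; rewrite sub_capmx => /andP[/sub_kermxP xT /sub_kermxP xW].
  exact: (nondeg_ker WT xW xT).
have PE : P *m proj_mx (kermx T) (kermx W) = P.
  by apply: proj_mx_id => //; apply/sub_kermxP; exact: proj_T.
have RE : (T *m Rm) *m proj_mx (kermx T) (kermx W) = 0.
  by apply: proj_mx_0 => //; apply/sub_kermxP; rewrite -mulmxA reeb_W mulmx0.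
rewrite -[LHS]mul1mx -{1}[1%:M](subrK (T *m Rm)) -/P mulmxDl.
by rewrite PE RE addr0.
Qed.

End CosymplecticMatrices.

Section CosymplecticPoint.
Local Open Scope ring_scope.
Variables (R : realType) (m p : nat).
Variables (w : tensor R m 2) (tau : 'I_p -> tensor R m 1).

Definition tau_mx : 'M[R]_(m, p) := \matrix_(i, k) tau k (delta_mx 0 i).

Hypotheses (wM : multilinear w) (tauM : forall k, multilinear (tau k)).

Lemma tauE k (x : 'rV[R]_m) : tau k x = (x *m tau_mx) 0 k.
Proof. by rewrite tensor1E // !mxE; apply: eq_bigr => j _; rewrite !mxE. Qed.

Lemma hat_Btensor : hat (Btensor w tau) = Bmx (hat w) tau_mx.
Proof.
apply/matrixP=> i j; rewrite !mxE; congr (_ + _); apply: eq_bigr => k _.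
by rewrite !mxE /tprod /rows2 col_mxKu col_mxKd.
Qed.

Lemma rows2_mul (x y : 'rV[R]_m) (A : 'M[R]_m) :
  rows2 x y *m A = rows2 (x *m A) (y *m A).
Proof. exact: mul_col_mx. Qed.

Lemma LamE (a b : 'rV[R]_m) :
  Lam w tau (rows2 a b) = (a *m lam_mx (hat w) tau_mx *m b^T) 0 0.
Proof.
rewrite /Lam hat_Btensor rows2_mul tensor2E //.
by rewrite trmx_mul /lam_mx mulmxN mulNmx [RHS]mxE !mulmxA.
Qed.

(** A common null vector of omega and the tau_k would be a null vector of the volume
   form, and omega^n cannot vanish identically. *)
Lemma cosymplectic_nondegenerate n (u : 'M[R]_(n * 2 + p, m)) :
  m = (2 * n + p)%N -> alternating w ->
  wedge (wedge_pow w n) (wedge_all tau) u != 0 -> wedge_pow w n.+1 =1 (fun=> 0) ->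
  nondegenerate (hat w) tau_mx.
Proof.
move=> Em wA wu w0.
have wS x y : w (rows2 y x) = - w (rows2 x y).
  have sk := alternating_hat wM wA.
  rewrite !tensor2E //.
  have -> : y *m hat w *m x^T = - (x *m hat w *m y^T)^T.
    by rewrite !trmx_mul trmxK sk mulNmx mulmxN opprK mulmxA.
  by rewrite !mxE.
split; first exact: alternating_hat.
  move=> x xW xT; apply/eqP; apply: contraNT wu => x0; apply/eqP.
  have [aM aS] : multilinear (wedge (wedge_pow w n) (wedge_all tau)) /\
       skew (wedge (wedge_pow w n) (wedge_all tau)).
    split; last exact: wedge_skew.
    by apply: wedge_multilinear; [exact: wedge_pow_multilinear | exact: wedge_all_multilinear].
  have Ek : (n * 2 + p = m)%N by rewrite Em mulnC.
  apply: (top_form_null _ Ek aM aS _ (multilinear_null0 aM) x0).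
  apply: wedge_null.
    apply: wedge_pow_null => v i Ei; rewrite -[v]rows2K.
    have wx y : w (rows2 x y) = 0 by rewrite tensor2E // xW mul0mx mxE.
    have [i0|i1] : i = ord0 \/ i = lift ord0 ord0.
      by case: (i) => [[|[|k]] Hk] //; [left|right]; apply: ord_inj.
      by rewrite -i0 Ei wx.
    by rewrite wS -i1 Ei wx oppr0.
  apply: wedge_all_null => k v i; rewrite (ord1 i) => Ei.
  have -> : v = x by rewrite -Ei; apply/rowP=> j; rewrite !mxE.
  by rewrite tauE xT mxE.
rewrite [X in (_ <= X)%N]Em leq_add2r mulnC.
have [v wv] : exists v, wedge_pow w n v != 0.
  apply/not_existsP => H; move: wu; rewrite /wedge big1 ?mulr0 ?eqxx // => s _.
  have := H (usubmx (row_perm s u)); rewrite /tprod => /negP; rewrite negbK => /eqP ->.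
  by rewrite mul0r mulr0.
exact: (wedge_pow_rank wM wS w0 wv).
Qed.

End CosymplecticPoint.

(** * Smooth functions on an open set *)

Section SmoothFunctions.
Local Open Scope classical_set_scope.
Local Open Scope ring_scope.
Variables (R : realType) (m : nat).
Local Notation V := 'rV[R]_m.
Implicit Types (A : set V) (k : nat).

(** The first-order expansion at x involves only values near x. *)
Lemma near_eq_differentiable (W : normedModType R) (f g : V -> W) x :
  (\near x, f x = g x) -> differentiable f x -> differentiable g x.
Proof.
move=> fg fd; have fgx := nbhs_singleton fg.
have E : g \o shift x = cst (g x) + 'd f x +o_ 0 id.
  apply/eqaddoP => e e0.
  have /eqaddoP/(_ e e0) := diff_locally fd.
  have H : \forall y \near 0, f (y + x) = g (y + x).
    by move: fg; rewrite (near_shift 0); apply: filterS => y /=; rewrite subr0.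
  apply: filterS2 H => y Hy; rewrite /= !fctE /= /cst.
  by rewrite /shift /= in Hy *; rewrite Hy fgx.
have dE := diff_unique (diff_continuous fd) E.
apply/diff_locallyP; rewrite dE; split=> //; exact: diff_continuous.
Qed.

Lemma open_near A x (P : V -> Prop) : open A -> A x ->
  (forall y, A y -> P y) -> \near x, P x.
Proof. by move=> Ao Ax H; apply: filterS (open_nbhs_nbhs (conj Ao Ax)). Qed.

Lemma derive_ext (W : normedModType R) (f g : V -> W) v u :
  f =1 g -> 'D_v f u = 'D_v g u.
Proof. by move=> /funext ->. Qed.

(** The recursion in [Ck] differentiates functions that are known on A only; openness
   of A makes their derivatives depend on nothing else. *)
Lemma Ck_eq (W : normedModType R) k A (f g : V -> W) : open A ->
  (forall x, A x -> f x = g x) -> Ck k A f -> Ck k A g.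
Proof.
move=> Ao; elim: k f g => [|k IHk] f g fg /=.
  move=> fc x Ax; have : f y @[y --> x] --> f x by exact: fc.
  rewrite (fg x Ax) => fx.
  have H : \near x, f x = g x by apply: (open_near Ao Ax).
  exact: (cvg_trans (near_eq_cvg H) fx).
case=> fd fk; split=> [x Ax | i].
  by apply: near_eq_differentiable (fd x Ax); apply: (open_near Ao Ax).
by apply: IHk (fk i) => x Ax; apply: near_eq_derive; apply: (open_near Ao Ax).
Qed.

Lemma Ck_pred (W : normedModType R) k A (f : V -> W) : Ck k.+1 A f -> Ck k A f.
Proof.
elim: k f => [|k IHk] f /= [fd fk].
  by move=> x Ax; apply: differentiable_continuous; apply: fd.
by split=> // i; apply: IHk (fk i).
Qed.

Lemma Ck_cst (W : normedModType R) k A (a : W) : Ck k A (fun=> a).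
Proof.
elim: k a => [|k IHk] a /=; first by move=> x _; apply: cst_continuous.
split=> [x _|i]; first exact: differentiable_cst.
have -> : (fun x : V => 'D_(delta_mx 0 i) (fun _ : V => a) x) = (fun=> 0).
  by apply/funext => x; exact: derive_cst.
exact: IHk.
Qed.

Lemma Ck_add (W : normedModType R) k A (f g : V -> W) : open A ->
  Ck k A f -> Ck k A g -> Ck k A (fun x => f x + g x).
Proof.
move=> Ao; elim: k f g => [|k IHk] f g /=.
  by move=> fc gc x Ax; apply: continuousD; [apply: fc|apply: gc].
move=> [fd fk] [gd gk]; split=> [x Ax|i]; first by apply: differentiableD; auto.
apply: (Ck_eq Ao) (IHk _ _ (fk i) (gk i)) => x Ax.
by rewrite -deriveD //; apply: diff_derivable; auto.
Qed.

Lemma Ck_mul k A (f g : V -> R) : open A ->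
  Ck k A f -> Ck k A g -> Ck k A (fun x => f x * g x).
Proof.
move=> Ao; elim: k f g => [|k IHk] f g.
  by move=> fc gc x Ax; apply: continuousM; [apply: fc|apply: gc].
move=> fk1 gk1; have [fk0 gk0] := (Ck_pred fk1, Ck_pred gk1).
case: fk1 gk1 => fd fk [gd gk]; split=> [x Ax|i].
  by apply: differentiableM; auto.
apply: (Ck_eq Ao) (Ck_add Ao (IHk _ _ fk0 (gk i)) (IHk _ _ gk0 (fk i))) => x Ax.
by rewrite [RHS]deriveM //; apply: diff_derivable; auto.
Qed.

Lemma Ck_inv k A (f : V -> R) : open A -> (forall x, A x -> f x != 0) ->
  Ck k A f -> Ck k A (fun x => (f x)^-1).
Proof.
move=> Ao f0; elim: k => [|k IHk].
  by move=> fc x Ax; apply: continuousV; [apply: f0|apply: fc].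
move=> fk1; have fi := IHk (Ck_pred fk1); case: fk1 => fd fk; split=> [x Ax|i].
  by apply: differentiableV; auto.
have := Ck_mul Ao (Ck_cst k A (-1 : R)) (Ck_mul Ao (Ck_mul Ao fi fi) (fk i)).
apply: (Ck_eq Ao) => x Ax.
rewrite [RHS]deriveV; [|by auto|by apply: diff_derivable; auto].
by rewrite mulN1r -exprVn expr2 scaleNr.
Qed.

Lemma Ck_scale (W : normedModType R) k A (f : V -> R) (e : W) : open A ->
  Ck k A f -> Ck k A (fun x => f x *: e).
Proof.
move=> Ao; elim: k f => [|k IHk] f /=.
  by move=> fc x Ax; apply: continuousZ; [apply: fc|apply: cst_continuous].
case=> fd fk; split=> [x Ax|i]; first by apply: differentiableZl; auto.
apply: (Ck_eq Ao) (IHk _ (fk i)) => x Ax.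
rewrite !deriveE; [|by apply: differentiableZl; auto|by auto].
by rewrite diffZl //; auto.
Qed.

Lemma Ck_coord k A n (f : V -> 'rV[R]_n) j : open A ->
  Ck k A f -> Ck k A (fun x => f x 0 j).
Proof.
move=> Ao; elim: k f => [|k IHk] f /=.
  move=> fc x Ax.
  exact: (continuous_comp (fc x Ax) (@coord_continuous _ _ _ 0 j _)).
case=> fd fk; split=> [x Ax|i].
  exact: (differentiable_comp (fd x Ax) (differentiable_coord _ 0 j)).
apply: (Ck_eq Ao) (IHk _ (fk i)) => x Ax.
by rewrite derive_mx ?mxE //; apply: diff_derivable; auto.
Qed.

End SmoothFunctions.

(** * Matrix-valued smooth functions and their derivatives *)

Section SmoothMatrices.
Local Open Scope classical_set_scope.
Local Open Scope ring_scope.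
Variables (R : realType) (m : nat).
Local Notation V := 'rV[R]_m.
Variable A : set V.
Hypothesis Ao : open A.

Lemma smooth_cst (W : normedModType R) (a : W) : smooth_on A (fun=> a).
Proof. by move=> k; apply: Ck_cst. Qed.

Lemma smooth_eq (W : normedModType R) (f g : V -> W) :
  (forall x, A x -> f x = g x) -> smooth_on A f -> smooth_on A g.
Proof. by move=> fg fs k; apply: (Ck_eq Ao fg). Qed.

Lemma smooth_add (W : normedModType R) (f g : V -> W) :
  smooth_on A f -> smooth_on A g -> smooth_on A (fun x => f x + g x).
Proof. by move=> fs gs k; apply: Ck_add. Qed.

Lemma smooth_mul (f g : V -> R) :
  smooth_on A f -> smooth_on A g -> smooth_on A (fun x => f x * g x).
Proof. by move=> fs gs k; apply: Ck_mul. Qed.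

Lemma smooth_inv (f : V -> R) : (forall x, A x -> f x != 0) ->
  smooth_on A f -> smooth_on A (fun x => (f x)^-1).
Proof. by move=> f0 fs k; apply: Ck_inv. Qed.

Lemma smooth_opp (f : V -> R) : smooth_on A f -> smooth_on A (fun x => - f x).
Proof.
move=> fs; apply: smooth_eq (smooth_mul (smooth_cst (-1 : R)) fs) => x _.
by rewrite mulN1r.
Qed.

Lemma smooth_sum (W : normedModType R) I (r : seq I) (f : I -> V -> W) :
  (forall i, smooth_on A (f i)) -> smooth_on A (fun x => \sum_(i <- r) f i x).
Proof.
move=> fs; elim: r => [|i r IHr].
  by apply: smooth_eq (smooth_cst (0 : W)) => x _; rewrite big_nil.
by apply: smooth_eq (smooth_add (fs i) IHr) => x _; rewrite big_cons.
Qed.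

Lemma smooth_prod I (r : seq I) (f : I -> V -> R) :
  (forall i, smooth_on A (f i)) -> smooth_on A (fun x => \prod_(i <- r) f i x).
Proof.
move=> fs; elim: r => [|i r IHr].
  by apply: smooth_eq (smooth_cst (1 : R)) => x _; rewrite big_nil.
by apply: smooth_eq (smooth_mul (fs i) IHr) => x _; rewrite big_cons.
Qed.

Lemma smooth_differentiable (W : normedModType R) (f : V -> W) x :
  smooth_on A f -> A x -> differentiable f x.
Proof. by move=> fs Ax; have [fd _] := fs 1%N; apply: fd. Qed.

Lemma smooth_rVP n (f : V -> 'rV[R]_n) :
  smooth_on A f <-> forall j, smooth_on A (fun x => f x 0 j).
Proof.
split=> [fs j k|fs]; first exact: Ck_coord.
have := smooth_sum (index_enum 'I_n) (fun j k => Ck_scale (delta_mx 0 j : 'rV[R]_n) Ao (fs j k)).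
by apply: smooth_eq => x _; rewrite -row_sum_delta.
Qed.

(** Entrywise, so that products of matrices reduce to sums of products of functions. *)
Definition smooth_mx a b (F : V -> 'M[R]_(a, b)) : Prop :=
  forall i j, smooth_on A (fun x => F x i j).

Lemma smooth_mx_cst a b (C : 'M[R]_(a, b)) : smooth_mx (fun=> C).
Proof. by move=> i j; apply: smooth_cst. Qed.

Lemma smooth_mx_add a b (F G : V -> 'M[R]_(a, b)) :
  smooth_mx F -> smooth_mx G -> smooth_mx (fun x => F x + G x).
Proof.
move=> Fs Gs i j; apply: smooth_eq (smooth_add (Fs i j) (Gs i j)) => x _.
by rewrite mxE.
Qed.

Lemma smooth_mx_opp a b (F : V -> 'M[R]_(a, b)) :
  smooth_mx F -> smooth_mx (fun x => - F x).
Proof.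
by move=> Fs i j; apply: smooth_eq (smooth_opp (Fs i j)) => x _; rewrite mxE.
Qed.

Lemma smooth_mx_mul a b c (F : V -> 'M[R]_(a, b)) (G : V -> 'M[R]_(b, c)) :
  smooth_mx F -> smooth_mx G -> smooth_mx (fun x => F x *m G x).
Proof.
move=> Fs Gs i j.
have := smooth_sum (index_enum 'I_b) (fun l => smooth_mul (Fs i l) (Gs l j)).
by apply: smooth_eq => x _; rewrite mxE.
Qed.

Lemma smooth_mx_tr a b (F : V -> 'M[R]_(a, b)) :
  smooth_mx F -> smooth_mx (fun x => (F x)^T).
Proof. by move=> Fs i j; apply: smooth_eq (Fs j i) => x _; rewrite mxE. Qed.

Lemma smooth_det a (F : V -> 'M[R]_a) :
  smooth_mx F -> smooth_on A (fun x => \det (F x)).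
Proof.
move=> Fs; apply: smooth_sum => s; apply: smooth_mul; first exact: smooth_cst.
exact: smooth_prod.
Qed.

(** By Cramer's formula. *)
Lemma smooth_mx_inv a (F : V -> 'M[R]_a) : (forall x, A x -> F x \in unitmx) ->
  smooth_mx F -> smooth_mx (fun x => invmx (F x)).
Proof.
move=> Fu Fs i j; have D0 x : A x -> \det (F x) != 0.
  by move=> /Fu; rewrite unitmxE unitfE.
have cs : smooth_on A (fun x => \adj (F x) i j).
  have : smooth_on A (fun x => cofactor (F x) j i).
    apply: smooth_mul; first exact: smooth_cst.
    apply: smooth_det => k l; apply: smooth_eq (Fs (lift j k) (lift i l)) => x _.
    by rewrite !mxE.
  by apply: smooth_eq => x _; rewrite mxE.
apply: smooth_eq (smooth_mul (smooth_inv D0 (smooth_det Fs)) cs) => x Ax.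
by rewrite /invmx Fu // [RHS]mxE.
Qed.

Definition mxder (v u : V) a b (F : V -> 'M[R]_(a, b)) : 'M[R]_(a, b) :=
  \matrix_(i, j) 'D_v (fun x => F x i j) u.

Variable u : V.
Hypothesis Au : A u.
Variable v : V.

Lemma smooth_mx_derivable a b (F : V -> 'M[R]_(a, b)) i j :
  smooth_mx F -> derivable (fun x => F x i j) u v.
Proof. by move=> Fs; apply: diff_derivable; apply: smooth_differentiable. Qed.

Lemma mxder_eq a b (F G : V -> 'M[R]_(a, b)) :
  (forall x, A x -> F x = G x) -> mxder v u F = mxder v u G.
Proof.
move=> FG; apply/matrixP=> i j; rewrite !mxE; apply: near_eq_derive.
by apply: (open_near Ao Au) => x Ax; rewrite FG.
Qed.

Lemma mxder_cst a b (C : 'M[R]_(a, b)) : mxder v u (fun=> C) = 0.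
Proof. by apply/matrixP=> i j; rewrite !mxE; apply: derive_cst. Qed.

Lemma mxder_eq0 a b (F : V -> 'M[R]_(a, b)) :
  (forall x, A x -> F x = 0) -> mxder v u F = 0.
Proof. by move=> F0; rewrite (mxder_eq F0) mxder_cst. Qed.

Lemma mxder_add a b (F G : V -> 'M[R]_(a, b)) : smooth_mx F -> smooth_mx G ->
  mxder v u (fun x => F x + G x) = mxder v u F + mxder v u G.
Proof.
move=> Fs Gs; apply/matrixP=> i j; rewrite !mxE.
rewrite -deriveD; try exact: smooth_mx_derivable.
by apply: derive_ext => x; rewrite !mxE.
Qed.

Lemma mxder_opp a b (F : V -> 'M[R]_(a, b)) : smooth_mx F ->
  mxder v u (fun x => - F x) = - mxder v u F.
Proof.
move=> Fs; apply/matrixP=> i j; rewrite !mxE.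
rewrite -deriveN; last exact: smooth_mx_derivable.
by apply: derive_ext => x; rewrite !mxE.
Qed.

Lemma mxder_tr a b (F : V -> 'M[R]_(a, b)) :
  mxder v u (fun x => (F x)^T) = (mxder v u F)^T.
Proof.
apply/matrixP=> i j; rewrite !mxE.
by apply: derive_ext => x; rewrite !mxE.
Qed.

Lemma mxder_mul a b c (F : V -> 'M[R]_(a, b)) (G : V -> 'M[R]_(b, c)) :
  smooth_mx F -> smooth_mx G ->
  mxder v u (fun x => F x *m G x) = mxder v u F *m G u + F u *m mxder v u G.
Proof.
move=> Fs Gs; apply/matrixP=> i j; rewrite !mxE.
transitivity ('D_v (\sum_l ((fun x => F x i l) * (fun x => G x l j))) u).
  by apply: derive_ext => x; rewrite mxE fct_sumE.
rewrite derive_sum => [|l]; last by apply: derivableM; apply: smooth_mx_derivable.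
rewrite -big_split; apply: eq_bigr => l _ /=.
rewrite deriveM; try exact: smooth_mx_derivable.
by rewrite !mxE addrC; congr (_ + _); rewrite mulrC.
Qed.

End SmoothMatrices.

(** * The Jacobi equations for fields of matrices *)

Section BilinearForm.
Local Open Scope ring_scope.
Variables (R : realType) (m : nat).

(** An abbreviation that lets identities between values of bilinear forms be proved as
   identities in a commutative ring. *)
Definition bil (M : 'M[R]_m) (x y : 'rV[R]_m) : R := (x *m M *m y^T) 0 0.

End BilinearForm.

(** Substitutes the equations in front of the goal. Comparing the atoms up to
   conversion would be very slow, so they are generalized first. *)
Ltac ring_atoms :=
  repeat match goal with
  | |- context [bil ?M ?x ?y] => generalize (bil M x y)
  end;
  repeat match goal with
  | |- context [fun_of_matrix ?M ?i ?j] => generalize (fun_of_matrix M i j)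
  end;
  intros; subst; ring.

Section MatrixFields.
Local Open Scope classical_set_scope.
Local Open Scope ring_scope.
Variables (R : realType) (m p : nat).
Local Notation V := 'rV[R]_m.

Lemma bil_tr (M : 'M[R]_m) x y : bil M^T x y = bil M y x.
Proof.
rewrite /bil; have -> : x *m M^T *m y^T = (y *m M *m x^T)^T.
  by rewrite !trmx_mul trmxK mulmxA.
by rewrite mxE.
Qed.

Lemma bilD (M N : 'M[R]_m) x y : bil (M + N) x y = bil M x y + bil N x y.
Proof. by rewrite /bil mulmxDr mulmxDl mxE. Qed.

Lemma bilN (M : 'M[R]_m) x y : bil (- M) x y = - bil M x y.
Proof. by rewrite /bil mulmxN mulNmx mxE. Qed.

Lemma bilNr (M : 'M[R]_m) x y : bil M x (- y) = - bil M x y.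
Proof. by rewrite /bil raddfN /= mulmxN mxE. Qed.

Lemma bil0l (M : 'M[R]_m) y : bil M 0 y = 0.
Proof. by rewrite /bil !mul0mx mxE. Qed.

Lemma bil0r (M : 'M[R]_m) x : bil M x 0 = 0.
Proof. by rewrite /bil trmx0 mulmx0 mxE. Qed.

Lemma bil0m (x y : V) : bil (0 : 'M[R]_m) x y = 0.
Proof. by rewrite /bil mulmx0 mul0mx mxE. Qed.

Lemma bil_mul (K M N : 'M[R]_m) x y : bil (K *m M *m N) x y = bil M (x *m K) (y *m N^T).
Proof. by rewrite /bil trmx_mul trmxK !mulmxA. Qed.

Lemma trmx_mul3 a b c d (X : 'M[R]_(a, b)) (Y : 'M[R]_(b, c)) (Z : 'M[R]_(c, d)) :
  (X *m Y *m Z)^T = Z^T *m Y^T *m X^T.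
Proof. by rewrite !trmx_mul mulmxA. Qed.

Variable A : set V.
Hypothesis Ao : open A.
Variables (W : V -> 'M[R]_m) (T : V -> 'M[R]_(m, p)).
Hypotheses (Ws : smooth_mx A W) (Ts : smooth_mx A T).
Hypothesis WT : forall y, A y -> nondegenerate (W y) (T y).
Local Notation L := (fun y => lam_mx (W y) (T y)).
Local Notation Rm := (fun y => reeb_mx (W y) (T y)).

Lemma Bmx_smooth : smooth_mx A (fun y => Bmx (W y) (T y)).
Proof. by apply: smooth_mx_add => //; apply: smooth_mx_mul => //; apply: smooth_mx_tr. Qed.

Lemma invB_smooth : smooth_mx A (fun y => invmx (Bmx (W y) (T y))).
Proof.
apply: smooth_mx_inv => //; last exact: Bmx_smooth.
by move=> y Ay; apply: Bmx_unit (WT Ay).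
Qed.

Lemma reeb_smooth : smooth_mx A Rm.
Proof.
by apply: smooth_mx_mul => //; [apply: smooth_mx_tr | apply: invB_smooth].
Qed.

Lemma lam_smooth : smooth_mx A L.
Proof.
have Bs := invB_smooth; apply: smooth_mx_opp => //; apply: smooth_mx_mul => //.
  exact: smooth_mx_mul.
exact: smooth_mx_tr.
Qed.

Variable u : V.
Hypothesis Au : A u.
Local Notation D v F := (mxder v u F).
Local Notation Lu := (lam_mx (W u) (T u)).
Local Notation Ru := (reeb_mx (W u) (T u)).

Lemma derive_W_skew v : (D v W)^T = - D v W.
Proof.
apply/eqP; rewrite -addr_eq0 -mxder_tr -(mxder_add Au _ (smooth_mx_tr Ao Ws) Ws).
apply/eqP; apply: (mxder_eq0 Ao Au) => x Ax.
by rewrite (nondeg_skew (WT Ax)) addNr.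
Qed.

(** From L W L = L one gets L' P + L W' L + P^t L' = L'; both P = 1 - T R and its
   transpose are eliminated with L' T = - L T', which comes from L T = 0. *)
Lemma derive_lam v : D v L =
  - (Lu *m D v W *m Lu) - Lu *m D v T *m Ru
  - Ru^T *m (D v T)^T *m Lu.
Proof.
have Ls := lam_smooth.
have E1 : D v L = D v (fun y => L y *m W y *m L y).
  by apply: (mxder_eq Ao Au) => y Ay; rewrite (lam_W_lam (WT Ay)).
have E2 : D v L *m T u = - (Lu *m D v T).
  have : D v (fun y => L y *m T y) = 0.
    apply: (mxder_eq0 Ao Au) => y Ay.
    exact: lam_T (WT Ay).
  by rewrite (mxder_mul Au _ Ls Ts) => /eqP; rewrite addr_eq0 => /eqP.
have E3 : (T u)^T *m D v L = - ((D v T)^T *m Lu).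
  have : D v (fun y => (T y)^T *m L y) = 0.
    apply: (mxder_eq0 Ao Au) => y Ay.
    apply: trmx_inj; rewrite trmx_mul trmxK (lam_skew (WT Ay)) mulNmx.
    by rewrite (lam_T (WT Ay)) oppr0 trmx0.
  by rewrite (mxder_mul Au _ (smooth_mx_tr Ao Ts) Ls) mxder_tr addrC => /eqP; rewrite addr_eq0 => /eqP.
have E2' : D v L *m (T u *m Ru) = - (Lu *m D v T *m Ru).
  by rewrite mulmxA E2 mulNmx.
have E3' : Ru^T *m (T u)^T *m D v L = - (Ru^T *m (D v T)^T *m Lu).
  by rewrite -mulmxA E3 mulmxN mulmxA.
move: E1; rewrite (mxder_mul Au _ (smooth_mx_mul Ao Ls Ws) Ls).
rewrite (mxder_mul Au _ Ls Ws) mulmxDl -[D v L *m W u *m Lu]mulmxA (W_lam (WT Au)).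
rewrite (lam_W (WT Au)) tr_proj_H /proj_H mulmxBl mulmxBr mul1mx mulmx1.
rewrite E2' E3' !opprK.
move: (D v L) => X; move: (Lu *m D v T *m Ru) => Y; move: (Ru^T *m _ *m Lu) => Z.
move: (Lu *m D v W *m Lu) => K E.
have : X + (Y + (K + Z)) = 0.
  apply: (addrI X); rewrite addr0 [RHS]E -!addrA; congr (_ + _).
  by rewrite !(addrCA X).
by move/eqP; rewrite addr_eq0 => /eqP ->; rewrite !opprD !addrA [- K - _]addrC.
Qed.

Lemma bil_derive_lam v (a b : V) : bil (D v L) a b =
  bil (D v W) (a *m Lu) (b *m Lu)
  - (a *m Lu *m D v T *m Ru *m b^T) 0 0 + (b *m Lu *m D v T *m Ru *m a^T) 0 0.
Proof.
have Lsk := lam_skew (WT Au).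
rewrite derive_lam !bilD !bilN; congr (_ + _ + _).
- by rewrite bil_mul Lsk (mulmxN b) bilNr opprK.
- by rewrite /bil !mulmxA.
rewrite -bilN -[RHS]mulr1.
have -> : - (Ru^T *m (D v T)^T *m Lu) = (Lu *m D v T *m Ru)^T.
  by rewrite trmx_mul3 Lsk [RHS]mulmxN.
by rewrite bil_tr /bil mulr1 !mulmxA.
Qed.

Variable E : V -> V.
Hypothesis Es : smooth_mx A E.

(** The exterior derivative of omega, at constant vector fields. *)
Definition extd_W (x y z : V) : R :=
  bil (D x W) y z - bil (D y W) x z + bil (D z W) x y.

(** The exterior derivatives of the tau_k, as a row vector indexed by k. *)
Definition extd_T (x y : V) : 'rV[R]_p := y *m D x T - x *m D y T.

(** The value of d omega - alpha /\ omega, for alpha = omega(., E). *)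
Definition defect_W (x y z : V) : R := extd_W x y z -
  (bil (W u) x (E u) * bil (W u) y z - bil (W u) y (E u) * bil (W u) x z
   + bil (W u) z (E u) * bil (W u) x y).

(** The row vector of the d tau_k - lambda_k omega, for lambda_k = - tau_k(E). *)
Definition defect_T (x y : V) : 'rV[R]_p :=
  extd_T x y + bil (W u) x y *: (E u *m T u).

(** The Lie derivative of omega along E. *)
Definition lie_W (x y : V) : R :=
  bil (D (E u) W) x y + bil (W u) (D x E) y + bil (W u) x (D y E).

(** The row vector of the iota_E d tau_k - d lambda_k for lambda_k = - tau_k(E): the
   derivative of tau along x cancels. *)
Definition lie_T (x : V) : 'rV[R]_p := x *m D (E u) T + D x E *m T u.

Local Notation sh a := (a *m Lu) (only parsing).

Lemma bil_lamE (a b : V) : bil Lu a b = - bil (W u) (sh a) (sh b).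
Proof.
rewrite -[X in bil X a b](lam_W_lam (WT Au)) bil_mul (lam_skew (WT Au)).
by rewrite (mulmxN b) bilNr.
Qed.

(** The decomposition of x into its horizontal part and its components along the R_k,
   seen by the covector a. *)
Lemma covectorE (a x : V) : (a *m x^T) 0 0 =
  bil (W u) (sh a) x + (x *m T u *m Ru *m a^T) 0 0.
Proof.
have -> : a *m x^T = (sh a) *m W u *m x^T + (x *m T u *m Ru *m a^T)^T.
  rewrite -[(sh a) *m _]mulmxA (lam_W (WT Au)) tr_proj_H trmx_mul3 trmxK.
  rewrite [(x *m T u)^T]trmx_mul mulmxBr mulmx1 mulmxBl -!mulmxA.
  by rewrite subrK.
by rewrite /bil !mxE.
Qed.

Lemma derive_W_swap v (x y : V) : bil (D v W) y x = - bil (D v W) x y.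
Proof. by rewrite -bil_tr derive_W_skew bilN. Qed.

Lemma W_swap (x y : V) : bil (W u) y x = - bil (W u) x y.
Proof. by rewrite -bil_tr (nondeg_skew (WT Au)) bilN. Qed.

Lemma lie_W_swap (x y : V) : lie_W y x = - lie_W x y.
Proof.
move: (derive_W_swap (E u) x y) (W_swap x (D y E)) (W_swap (D x E) y).
rewrite /lie_W.
ring_atoms.
Qed.

(** The left-hand side is 1/2 [Lambda, Lambda] + E /\ Lambda. After substitution of
   [derive_lam] both sides are the same polynomial in the values of omega, tau and
   their derivatives at the vectors a^#, b^#, c^#. *)
Lemma jacobi_LL_defect (a b c : V) :
  bil (D (sh a) L) b c + bil (D (sh b) L) c a + bil (D (sh c) L) a b
  + ((a *m (E u)^T) 0 0 * bil Lu b c + (b *m (E u)^T) 0 0 * bil Lu c a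
     + (c *m (E u)^T) 0 0 * bil Lu a b)
  = defect_W (sh a) (sh b) (sh c) - ((defect_T (sh a) (sh b) *m Ru *m c^T) 0 0
     + (defect_T (sh b) (sh c) *m Ru *m a^T) 0 0
     + (defect_T (sh c) (sh a) *m Ru *m b^T) 0 0).
Proof.
have lin (x y : 'rV[R]_p) s (d : V) : ((x - y + s *: (E u *m T u)) *m Ru *m d^T) 0 0 =
  (x *m Ru *m d^T) 0 0 - (y *m Ru *m d^T) 0 0 + s * (E u *m T u *m Ru *m d^T) 0 0.
  by rewrite !mulmxDl !mulNmx -!scalemxAl !mxE.
have tE x y (d : V) : (defect_T x y *m Ru *m d^T) 0 0 =
    (y *m D x T *m Ru *m d^T) 0 0 - (x *m D y T *m Ru *m d^T) 0 0
    + bil (W u) x y * (E u *m T u *m Ru *m d^T) 0 0 by exact: lin.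
move: (tE (sh a) (sh b) c) (tE (sh b) (sh c) a) (tE (sh c) (sh a) b).
move: (bil_derive_lam (sh a) b c) (bil_derive_lam (sh b) c a) (bil_derive_lam (sh c) a b).
move: (bil_lamE a b) (bil_lamE b c) (bil_lamE c a).
move: (covectorE a (E u)) (covectorE b (E u)) (covectorE c (E u)).
move: (derive_W_swap (sh b) (sh c) (sh a)) (W_swap (sh c) (sh a)).
rewrite /defect_W /extd_W.
ring_atoms.
Qed.

(** The left-hand side is [Lambda, E], by the same substitution. *)
Lemma jacobi_LE_defect (a b : V) :
  (b *m (D (sh a) E)^T) 0 0 - (a *m (D (sh b) E)^T) 0 0 - bil (D (E u) L) a b
  = - lie_W (sh a) (sh b) + (lie_T (sh a) *m Ru *m b^T) 0 0
    - (lie_T (sh b) *m Ru *m a^T) 0 0.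
Proof.
have lin (x y : 'rV[R]_p) (d : V) : ((x + y) *m Ru *m d^T) 0 0 =
  (x *m Ru *m d^T) 0 0 + (y *m Ru *m d^T) 0 0.
  by rewrite !mulmxDl !mxE.
have tE x (d : V) : (lie_T x *m Ru *m d^T) 0 0 =
    (x *m D (E u) T *m Ru *m d^T) 0 0 + (D x E *m T u *m Ru *m d^T) 0 0.
  exact: lin.
move: (tE (sh a) b) (tE (sh b) a) (bil_derive_lam (E u) a b).
move: (covectorE a (D (sh b) E)) (covectorE b (D (sh a) E)).
move: (W_swap (sh b) (D (sh a) E)); rewrite /lie_W.
ring_atoms.
Qed.

End MatrixFields.

(** * Wedge products of forms of degree at most two *)

Section LowDegreeWedges.
Local Open Scope ring_scope.
Variables (R : realType) (m : nat).

Definition rows3 (x y z : 'rV[R]_m) : 'M[R]_(1 + 2, m) := col_mx x (rows2 y z).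

Lemma rows2P (v : 'M[R]_(1 + 1, m)) : exists x y, v = rows2 x y.
Proof. by exists (row ord0 v), (row (lift ord0 ord0) v); rewrite rows2K. Qed.

Lemma rows3P (v : 'M[R]_(1 + 2, m)) : exists x y z, v = rows3 x y z.
Proof.
have [y [z E]] := rows2P (dsubmx v).
by exists (usubmx v), y, z; rewrite /rows3 -E vsubmxK.
Qed.

Lemma row0_id (x : 'rV[R]_m) : row ord0 x = x.
Proof. by apply/rowP=> j; rewrite !mxE. Qed.

Lemma row'_rows2_0 (x y : 'rV[R]_m) : row' ord0 (rows2 x y) = y.
Proof. exact: row'0_col_mx. Qed.

Lemma row'_rows2_1 (x y : 'rV[R]_m) : row' (lift ord0 ord0) (rows2 x y) = x.
Proof.
by rewrite -[LHS]row0_id row_row' lift_lift0 row_rows2_0.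
Qed.

Lemma row'_rows3_0 (x y z : 'rV[R]_m) : row' ord0 (rows3 x y z) = rows2 y z.
Proof. exact: row'0_col_mx. Qed.

Lemma row'_rows3_1 (x y z : 'rV[R]_m) :
  row' (lift ord0 ord0) (rows3 x y z) = rows2 x z.
Proof. by rewrite /rows3 row'_lift0_col_mx row'_rows2_0. Qed.

Lemma row'_rows3_2 (x y z : 'rV[R]_m) :
  row' (lift ord0 (lift ord0 ord0)) (rows3 x y z) = rows2 x y.
Proof. by rewrite /rows3 row'_lift0_col_mx row'_rows2_1. Qed.

Lemma row_rows3_0 (x y z : 'rV[R]_m) : row ord0 (rows3 x y z) = x.
Proof. exact: row0_col_mx. Qed.

Lemma row_rows3_1 (x y z : 'rV[R]_m) : row (lift ord0 ord0) (rows3 x y z) = y.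
Proof. by rewrite /rows3 row_lift0_col_mx row_rows2_0. Qed.

Lemma row_rows3_2 (x y z : 'rV[R]_m) :
  row (lift ord0 (lift ord0 ord0)) (rows3 x y z) = z.
Proof. by rewrite /rows3 row_lift0_col_mx row_rows2_1. Qed.

Lemma rows3_mul (x y z : 'rV[R]_m) (M : 'M[R]_m) :
  rows3 x y z *m M = rows3 (x *m M) (y *m M) (z *m M).
Proof. by rewrite /rows3 [LHS](mul_col_mx x (rows2 y z)) rows2_mul. Qed.

Definition rowsE := (row'_rows2_0, row'_rows2_1, row'_rows3_0, row'_rows3_1,
  row'_rows3_2, row_rows2_0, row_rows2_1, row_rows3_0, row_rows3_1, row_rows3_2).

Lemma wedge11E (a b : tensor R m 1) x y :
  wedge a b (rows2 x y) = a x * b y - a y * b x.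
Proof.
rewrite wedge1E; last exact: skew1.
by rewrite /wedge1 !big_ord_recl big_ord0 !rowsE /= expr0 expr1 mul1r mulN1r addr0.
Qed.

Lemma wedge12E (a : tensor R m 1) (b : tensor R m 2) x y z : skew b ->
  wedge a b (rows3 x y z) =
  a x * b (rows2 y z) - a y * b (rows2 x z) + a z * b (rows2 x y).
Proof.
move=> bS; rewrite wedge1E // /wedge1 !big_ord_recl big_ord0 !rowsE /=.
by rewrite /bump /= !exprS expr0 !mulr1 !mulN1r opprK !mul1r addr0 addrA.
Qed.

(** A 2-form commutes with a 1-form, so the value is that of [wedge12E]. *)
Lemma wedge21E (a : tensor R m 1) (b : tensor R m 2) x y z :
  (forall x y, b (rows2 y x) = - b (rows2 x y)) ->
  wedge b a (rows3 x y z : 'M[R]_(2 + 1, m)) =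
  a x * b (rows2 y z) - a y * b (rows2 x z) + a z * b (rows2 x y).
Proof.
move=> bS; rewrite wedge2E; last exact: skew1.
rewrite !big_ord_recl !big_ord0 !rowsE /= /bump /=.
rewrite (bS x y) (bS x z) (bS y z) ?addn0 !exprS expr0.
by field.
Qed.

End LowDegreeWedges.

(** * Schouten brackets in coordinates *)

Section CoordinateCalculus.
Local Open Scope classical_set_scope.
Local Open Scope ring_scope.
Variables (R : realType) (m : nat).
Local Notation V := 'rV[R]_m.
Variable A : set V.
Hypothesis Ao : open A.
Variable u : V.
Hypothesis Au : A u.
Local Notation D v F := (mxder v u F).

Lemma derive_lincomb (f : V -> R) (x : V) : differentiable f u ->
  'D_x f u = \sum_l x 0 l * 'D_(delta_mx 0 l) f u.
Proof.
move=> fd; rewrite (linear_expand (f := fun x => 'D_x f u)) // => b1 b2 x1 x2.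
by rewrite !deriveE // linearP linearZ.
Qed.

Lemma mxder_linear a b (F : V -> 'M[R]_(a, b)) b1 b2 (x y : V) : smooth_mx A F ->
  D (b1 *: x + b2 *: y) F = b1 *: D x F + b2 *: D y F.
Proof.
move=> Fs; apply/matrixP=> i j; rewrite !mxE.
have fd : differentiable (fun z => F z i j) u.
  exact: smooth_differentiable (Fs i j) Au.
by rewrite !deriveE // linearP linearZ.
Qed.

Lemma mxder_lincomb a b (F : V -> 'M[R]_(a, b)) (x : V) : smooth_mx A F ->
  D x F = \sum_l x 0 l *: D (delta_mx 0 l) F.
Proof.
move=> Fs; apply/matrixP=> i j; rewrite mxE summxE derive_lincomb.
  by apply: eq_bigr => l _; rewrite !mxE.
exact: smooth_differentiable (Fs i j) Au.
Qed.

Lemma bil_mxder_lincomb (F : V -> 'M[R]_m) (x y z : V) : smooth_mx A F ->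
  bil (D x F) y z = \sum_l x 0 l * bil (D (delta_mx 0 l) F) y z.
Proof.
move=> Fs; rewrite /bil (mxder_lincomb x Fs).
rewrite mulmx_sumr mulmx_suml summxE; apply: eq_bigr => l _.
by rewrite -scalemxAr -scalemxAl mxE.
Qed.

Lemma derive_bil (F : V -> 'M[R]_m) (v x y : V) : smooth_mx A F ->
  'D_v (fun z => bil (F z) x y) u = bil (D v F) x y.
Proof.
move=> Fs; have xF := smooth_mx_mul Ao (smooth_mx_cst A x) Fs.
transitivity (D v (fun z => x *m F z *m y^T) 0 0); first by rewrite mxE.
rewrite (mxder_mul Au v xF (smooth_mx_cst A y^T)).
rewrite (mxder_mul Au v (smooth_mx_cst A x) Fs).
by rewrite !mxder_cst mul0mx add0r mulmx0 addr0.
Qed.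

Lemma derive_covec k (F : V -> 'M[R]_(m, k)) (v x : V) i : smooth_mx A F ->
  'D_v (fun z => (x *m F z) 0 i) u = (x *m D v F) 0 i.
Proof.
move=> Fs; transitivity (D v (fun z => x *m F z) 0 i); first by rewrite mxE.
by rewrite (mxder_mul Au v (smooth_mx_cst A x) Fs) !mxder_cst mul0mx add0r.
Qed.

Lemma smooth_mx_rV (E : V -> V) : smooth_mx A E <-> smooth_on A E.
Proof.
rewrite smooth_rVP //; split=> [Es j|Es i j]; first exact: Es.
by rewrite (ord1 i).
Qed.

Lemma derive_vec (E : V -> V) v : smooth_mx A E -> 'D_v E u = D v E.
Proof.
move=> Es; rewrite derive_mx //; apply/derivable_mxP => i j.
exact: (smooth_mx_derivable Au Es).
Qed.

Lemma bil_delta (M : 'M[R]_m) (x : V) l : bil M x (delta_mx 0 l) = (x *m M) 0 l.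
Proof. by rewrite /bil trmx_delta -colE mxE. Qed.

Lemma extd_T_linear p (F : V -> 'M[R]_(m, p)) b1 b2 (x y z : V) k :
  smooth_mx A F ->
  extd_T F u z (b1 *: x + b2 *: y) 0 k =
  b1 * extd_T F u z x 0 k + b2 * extd_T F u z y 0 k.
Proof.
move=> Fs; rewrite /extd_T (mxder_linear b1 b2 x y Fs).
move: (D x F) (D y F) (D z F) => Dx Dy Dz.
by rewrite mulmxDl mulmxDr -!scalemxAl -!scalemxAr !mxE; ring.
Qed.

Section Schouten.
Variables (Q : lfield R m 2) (L : V -> 'M[R]_m).
Hypothesis Ls : smooth_mx A L.
Hypothesis Lsk : forall y, A y -> (L y)^T = - L y.
Hypothesis QE : forall y, A y -> forall x z, Q y (rows2 x z) = bil (L y) x z.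

Let derive_Q l x z :
  'D_(delta_mx 0 l) (fun y => Q y (rows2 x z)) u = bil (D (delta_mx 0 l) L) x z.
Proof.
rewrite -derive_bil //; apply: near_eq_derive.
by apply: (open_near Ao Au) => y Ay; rewrite QE.
Qed.

Let DL_swap v x z : bil (D v L) z x = - bil (D v L) x z.
Proof.
rewrite -bil_tr -bilN; congr bil; apply/eqP; rewrite -addr_eq0 -mxder_tr.
rewrite -(mxder_add Au _ (smooth_mx_tr Ao Ls) Ls); apply/eqP.
by apply: (mxder_eq0 Ao Au) => y Ay; rewrite Lsk // addNr.
Qed.

(** The two sums in the definition of the bracket agree, because Lambda(dx^l, .) is
   opposite to Lambda(., dx^l) and a 1-form commutes with a 2-form. *)
Lemma schouten_bivector (a b c : V) :
  @schouten R m 1 1 Q Q u (rows3 a b c) =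
  2 * (bil (D (a *m L u) L) b c + bil (D (b *m L u) L) c a
       + bil (D (c *m L u) L) a b).
Proof.
pose e l : V := delta_mx 0 l.
transitivity (2 * (\sum_l (a *m L u) 0 l * bil (D (e l) L) b c
  + \sum_l (b *m L u) 0 l * bil (D (e l) L) c a
  + \sum_l (c *m L u) 0 l * bil (D (e l) L) a b)); last first.
  by congr (2 * (_ + _ + _)); apply/esym; apply: bil_mxder_lincomb.
rewrite -!big_split big_distrr /=; apply: eq_bigr => l _; rewrite /e.
rewrite (castmx_id _ (rows3 a b c : 'M[R]_(3, m))).
set dQ := fun z => 'D_(delta_mx 0 l) (fun y => Q y z) u.
have dQS x z : dQ (rows2 z x) = - dQ (rows2 x z).
  by rewrite /dQ !derive_Q DL_swap.
rewrite wedge12E; last exact: skew2.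
rewrite wedge21E // /contract /dQ !derive_Q.
have P1 (z : V) : Q u (col_mx z (delta_mx 0 l : V)) = (z *m L u) 0 l.
  by rewrite [LHS](QE Au) bil_delta.
have P2 (z : V) : Q u (col_mx (delta_mx 0 l : V) z) = - (z *m L u) 0 l.
  by rewrite [LHS](QE Au) -bil_tr Lsk // bilN bil_delta.
rewrite !P1 !P2 (DL_swap _ a c).
ring.
Qed.

(** Summing over l turns the derivatives along the coordinate vectors into derivatives
   along a^#, b^# and E. *)
Lemma schouten_vector (E : V -> V) (a b : V) : smooth_mx A E ->
  @schouten R m 1 0 Q (fun y => vec1 (E y)) u (rows2 a b) =
  (b *m (D (a *m L u) E)^T) 0 0 - (a *m (D (b *m L u) E)^T) 0 0
  - bil (D (E u) L) a b.
Proof.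
move=> Es.
have Ets := smooth_mx_tr Ao Es.
have dE v (z : V) : 'D_v (fun y => vec1 (E y) z) u = (z *m (D v E)^T) 0 0.
  by rewrite -mxder_tr -(derive_covec _ _ _ Ets).
have linE (x z : V) : (z *m (D x E)^T) 0 0 =
    \sum_l x 0 l * (z *m (D (delta_mx 0 l) E)^T) 0 0.
  apply: (etrans (esym (dE x z))); rewrite derive_lincomb.
    by apply: eq_bigr => l _; congr (_ * _); apply: dE.
  apply: smooth_differentiable Au.
  exact: (smooth_mx_mul Ao (smooth_mx_cst A z) Ets).
pose e l : V := delta_mx 0 l.
transitivity (\sum_l (a *m L u) 0 l * (b *m (D (e l) E)^T) 0 0
  - \sum_l (b *m L u) 0 l * (a *m (D (e l) E)^T) 0 0
  - \sum_l E u 0 l * bil (D (e l) L) a b); last first.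
  by congr (_ - _ - _); apply/esym; [apply: linE|apply: linE|apply: bil_mxder_lincomb].
rewrite -!sumrB /e.
apply: eq_bigr => l _; rewrite (castmx_id _ (rows2 a b : 'M[R]_(2, m))).
rewrite wedge11E.
set dQ := fun z => 'D_(delta_mx 0 l) (fun y => Q y z) u.
rewrite wedge2_0; last first.
  by move=> x z; rewrite /dQ !derive_Q DL_swap.
have P1 (z : V) : Q u (col_mx z (delta_mx 0 l : V)) = (z *m L u) 0 l.
  by rewrite [LHS](QE Au) bil_delta.
rewrite !P1 !dE /dQ derive_Q /contract /vec1.
have e0 : col_mx (delta_mx 0 l : V) (0 : 'M[R]_(0, m)) = delta_mx 0 l :> V.
  exact: etrans (esym (row0_id _)) (row0_col_mx _ _).
rewrite e0; congr (_ - _).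
rewrite mulrC; congr (_ * _); rewrite -rowE !mxE.
by [].
Qed.

End Schouten.

End CoordinateCalculus.

(** * The Jacobi equations in a chart *)

Section LocalEquivalences.
Local Open Scope classical_set_scope.
Local Open Scope ring_scope.
Variables (R : realType) (m p : nat).
Local Notation V := 'rV[R]_m.
Variable A : set V.
Hypothesis Ao : open A.
Variables (w : lfield R m 2) (tau : 'I_p -> lfield R m 1).
Hypothesis wM : forall y, A y -> multilinear (w y).
Hypothesis wS : forall v, smooth_on A (fun y => w y v).
Hypothesis tM : forall k y, A y -> multilinear (tau k y).
Hypothesis tS : forall k v, smooth_on A (fun y => tau k y v).
Local Notation W := (fun y => hat (w y)).
Local Notation T := (fun y => tau_mx (fun k => tau k y)).
Hypothesis WT : forall y, A y -> nondegenerate (W y) (T y).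

Lemma hat_smooth : smooth_mx A W.
Proof. by move=> i j; apply: smooth_eq (wS _) => // y _; rewrite mxE. Qed.

Lemma tau_mx_smooth : smooth_mx A T.
Proof. by move=> i j; apply: smooth_eq (tS _ _) => // y _; rewrite mxE. Qed.

Lemma form2E y (a b : V) : A y -> w y (rows2 a b) = bil (W y) a b.
Proof. by move=> Ay; rewrite tensor2E //; apply: wM. Qed.

Lemma form1E k y (a : V) : A y -> tau k y a = (a *m T y) 0 k.
Proof. by move=> Ay; rewrite (tauE (tau := fun k => tau k y)) // => j; apply: tM. Qed.

Lemma bivectorE y (a b : V) : A y ->
  Lam (w y) (fun k => tau k y) (rows2 a b) = bil (lam_mx (W y) (T y)) a b.
Proof. by move=> Ay; rewrite LamE //; apply: wM. Qed.

Lemma prHE y : A y -> prH (w y) (fun k => tau k y) = proj_H (W y) (T y).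
Proof. by move=> Ay; rewrite -(proj_mx_kernels (WT Ay)). Qed.

Variable u : V.
Hypothesis Au : A u.
Local Notation D v F := (mxder v u F).
Local Notation Lu := (lam_mx (W u) (T u)).
Local Notation Ru := (reeb_mx (W u) (T u)).
Local Notation Pu := (proj_H (W u) (T u)).

Lemma derive_form2 v (a b : V) :
  'D_v (fun y => w y (rows2 a b)) u = bil (D v W) a b.
Proof.
apply: etrans (derive_bil Ao Au v a b hat_smooth).
by apply: near_eq_derive; apply: (open_near Ao Au) => y Ay; apply: form2E.
Qed.

Lemma derive_form1 v k (a : V) : 'D_v (fun y => tau k y a) u = (a *m D v T) 0 k.
Proof.
apply: etrans (derive_covec Au v a k tau_mx_smooth).
by apply: near_eq_derive; apply: (open_near Ao Au) => y Ay; apply: form1E.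
Qed.

Lemma dext_form2 (x y z : V) : dext w u (rows3 x y z) = extd_W W u x y z.
Proof.
rewrite /dext !big_ord_recl big_ord0 !rowsE /= /bump /= addn0.
by rewrite !derive_form2 !exprS expr0 !mulr1 !mulN1r opprK !mul1r addr0 addrA.
Qed.

Lemma dext_form1 k (x y : V) :
  dext (tau k) u (rows2 x y) = (extd_T T u x y) 0 k.
Proof.
rewrite /dext !big_ord_recl big_ord0 !rowsE /= /bump /= addn0.
by rewrite !derive_form1 !exprS expr0 !mulr1 !mulN1r !mul1r addr0 !mxE.
Qed.

Lemma sum_ord2 (f : 'I_2 -> R) : \sum_i f i = f ord0 + f (lift ord0 ord0).
Proof. by rewrite !big_ord_recl big_ord0 addr0. Qed.

Lemma lie_form2 (E : V -> V) (x y : V) : smooth_mx A E ->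
  lie E w u (rows2 x y) = lie_W W u E x y.
Proof.
move=> Es; rewrite /lie /lie_W.
apply: etrans (addrA _ _ _); congr (_ + _); first exact: derive_form2.
apply: etrans (sum_ord2 _) _; congr (_ + _).
  apply: etrans (form2E _ _ Au); congr (w u _).
  rewrite -(derive_vec Au x Es); set d := 'D_x E u.
  rewrite -[LHS]rows2K; congr rows2; apply/rowP=> j; rewrite !mxE /=.
    by rewrite row_rows2_0.
  have := congr1 (fun r : V => r 0 j) (row_rows2_1 x y); rewrite !mxE => <-.
  by rewrite ?mxE.
apply: etrans (form2E _ _ Au); congr (w u _).
rewrite -(derive_vec Au y Es); set d := 'D_y E u.
rewrite -[LHS]rows2K; congr rows2; apply/rowP=> j; rewrite !mxE /=.
  have := congr1 (fun r : V => r 0 j) (row_rows2_0 x y); rewrite !mxE => <-.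
  by rewrite ?mxE.
by rewrite row_rows2_1.
Qed.

(** The vectors a^# exhaust the horizontal space. *)
Lemma sharp_proj (x : V) : exists a : V, x *m Pu = a *m Lu.
Proof. by exists (x *m W u); rewrite -mulmxA (W_lam (WT Au)). Qed.

Lemma proj_sharp (a : V) : a *m Lu *m Pu = a *m Lu.
Proof. by rewrite -mulmxA (lam_proj (WT Au)). Qed.

(** This and [reeb_coord] are the two properties of the covector tau_k by which it
   isolates one summand of the defects. *)
Lemma dual_sharp k : row k (T u)^T *m Lu = 0.
Proof.
rewrite -row_mul; have -> : (T u)^T *m Lu = 0; last by rewrite row0.
apply: trmx_inj; rewrite trmx_mul trmxK (lam_skew (WT Au)) mulNmx.
by rewrite (lam_T (WT Au)) oppr0 trmx0.
Qed.

Lemma reeb_coord k (x : 'rV[R]_p) : (x *m Ru *m (row k (T u)^T)^T) 0 0 = x 0 k.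
Proof.
rewrite tr_row trmxK -mulmxA colE [Ru *m _]mulmxA (reeb_T (WT Au)) mul1mx.
by rewrite -colE mxE.
Qed.

Lemma mxder0 a b (F : V -> 'M[R]_(a, b)) : D 0 F = 0.
Proof. by apply/matrixP=> i j; rewrite !mxE derive0. Qed.

Variable E : V -> V.
Hypothesis Es : smooth_mx A E.
Variables (abar : tensor R m 1) (lam : 'I_p -> V -> R).
Hypothesis abarE : forall x, abar x = bil (W u) x (E u).
Hypothesis lamE : forall k y, A y -> lam k y = - (E y *m T y) 0 k.
Local Notation Q := (fun y => Lam (w y) (fun k => tau k y)).
Local Notation prHu := (prH (w u) (fun k => tau k u)).
Local Notation sh a := (a *m Lu).
Local Notation dW := (defect_W W u E).
Local Notation dT := (defect_T W T u E).
Local Notation lW := (lie_W W u E).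
Local Notation lT := (lie_T T u E).

Lemma defect_W_0 (x y : V) : dW x y 0 = 0.
Proof. by rewrite /defect_W /extd_W mxder0 !bil0m !bil0r bil0l; ring. Qed.

Lemma defect_T_0 (x : V) : dT x 0 = 0 /\ dT 0 x = 0.
Proof.
by rewrite /defect_T /extd_T mxder0 bil0r bil0l !mul0mx !mulmx0 !subr0 !scale0r !addr0.
Qed.

Lemma lie_T_0 : lT 0 = 0.
Proof. by rewrite /lie_T mxder0 !mul0mx addr0. Qed.

Lemma lie_W_0 (x : V) : lW x 0 = 0.
Proof. by rewrite /lie_W mxder0 !bil0r !addr0. Qed.

(** Both members are evaluated on vectors x P, which are the a^#; alpha takes the same
   value at x and at x P because omega does. *)
Lemma condition_i_defect :
  (pullback prHu (dext w u) =1 wedge abar (pullback prHu (w u))) <->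
  (forall a b c : V, dW (sh a) (sh b) (sh c) = 0).
Proof.
have abarP x : abar x = bil (W u) (x *m Pu) (E u).
  by rewrite abarE /bil -[x *m Pu *m _]mulmxA (proj_W (WT Au)).
have H x y z :
    (pullback prHu (dext w u) (rows3 x y z) =
     wedge abar (pullback prHu (w u)) (rows3 x y z)) <->
    dW (x *m Pu) (y *m Pu) (z *m Pu) = 0.
  have e2 s t : pullback prHu (w u) (rows2 s t) = bil (W u) (s *m Pu) (t *m Pu).
    by rewrite /pullback rows2_mul prHE // form2E.
  rewrite wedge12E ?e2; last first.
    apply: skew2 => s t; rewrite !e2.
    exact: (W_swap WT Au).
  have -> : pullback prHu (dext w u) (rows3 x y z) =
    dext w u (rows3 (x *m Pu) (y *m Pu) (z *m Pu)).
    by rewrite /pullback prHE // rows3_mul.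
  rewrite dext_form2 !abarP /defect_W.
  by split=> [->|/eqP]; rewrite ?subrr // subr_eq0 => /eqP.
split=> [H0 a b c|H0 v].
  by have := (H (sh a) (sh b) (sh c)).1 (H0 _); rewrite !proj_sharp.
have [x [y [z ->]]] := rows3P v; apply/H.
by have [[a ->] [[b ->] [c ->]]] := (sharp_proj x, (sharp_proj y, sharp_proj z)).
Qed.

Lemma condition_ii_defect :
  (forall k, pullback prHu (dext (tau k) u) =1
             (fun v => lam k u * pullback prHu (w u) v)) <->
  (forall a b : V, dT (sh a) (sh b) = 0).
Proof.
have H k x y :
    (pullback prHu (dext (tau k) u) (rows2 x y) =
     lam k u * pullback prHu (w u) (rows2 x y)) <->
    dT (x *m Pu) (y *m Pu) 0 k = 0.
  rewrite /pullback rows2_mul prHE // form2E // dext_form1 lamE //.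
  rewrite /defect_T [X in _ <-> (X = 0)]mxE [X in _ + X]mxE.
  rewrite mulNr mulrC; split=> [->|/eqP]; rewrite ?addNr // addr_eq0 => /eqP.
  by [].
split=> [H0 a b|H0 k v].
  apply/rowP => k; have := (H k (sh a) (sh b)).1 (H0 _ _).
  by rewrite !proj_sharp => ->; rewrite mxE.
have [x [y ->]] := rows2P v; apply/H.
by have [[a ->] [b ->]] := (sharp_proj x, sharp_proj y); rewrite H0 mxE.
Qed.

Lemma condition_iii_tau_defect :
  (forall k, pullback prHu (contract (E u) (dext (tau k) u)) =1
             pullback prHu (dfun (lam k) u)) <->
  (forall a : V, lT (sh a) = 0).
Proof.
have H k (x : V) :
    (pullback prHu (contract (E u) (dext (tau k) u)) x =
     pullback prHu (dfun (lam k) u) x) <-> lT (x *m Pu) 0 k = 0.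
  rewrite /pullback prHE //; set y := x *m Pu.
  have -> : contract (E u) (dext (tau k) u) y = extd_T T u (E u) y 0 k.
    exact: dext_form1.
  have -> : dfun (lam k) u y = (- (D y E *m T u + E u *m D y T)) 0 k.
    rewrite /dfun -(mxder_mul Au y Es tau_mx_smooth).
    rewrite -(mxder_opp Au y (smooth_mx_mul Ao Es tau_mx_smooth)) [RHS]mxE.
    apply: near_eq_derive; apply: (open_near Ao Au) => z Az.
    by rewrite lamE // [RHS]mxE.
  rewrite /extd_T /lie_T; set X1 := y *m _; set X2 := E u *m _; set X3 := _ *m T u.
  move: X1 X2 X3 => X1 X2 X3; rewrite !mxE; move: (X1 0 k) (X2 0 k) (X3 0 k).
  move=> x1 x2 x3; split=> [E0|/eqP].
    by rewrite -[x1](subrK x2) E0; ring.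
  by rewrite addr_eq0 => /eqP ->; ring.
split=> [H0 a|H0 k x].
  apply/rowP => k; have := (H k (sh a)).1 (H0 _ _).
  by rewrite proj_sharp => ->; rewrite mxE.
by apply/H; have [a ->] := sharp_proj x; rewrite H0 mxE.
Qed.

Lemma condition_iii_w_defect :
  (pullback prHu (lie E w u) =1 (fun=> 0)) <->
  (forall a b : V, lW (sh a) (sh b) = 0).
Proof.
have H x y : pullback prHu (lie E w u) (rows2 x y) = lW (x *m Pu) (y *m Pu).
  by rewrite /pullback rows2_mul prHE // lie_form2.
split=> [H0 a b|H0 v].
  by have := H (sh a) (sh b); rewrite H0 !proj_sharp.
have [x [y ->]] := rows2P v; rewrite H.
by have [[a ->] [b ->]] := (sharp_proj x, sharp_proj y).
Qed.

(** The choice c = tau_k in [jacobi_LL_defect] leaves only the k-th coordinate of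
   [defect_T]; once these vanish, so does [defect_W]. *)
Lemma jacobi_LL_equiv :
  (@schouten R m 1 1 Q Q u =1 (fun eta => - 2 * wedge (vec1 (E u)) (Q u) eta)) <->
  (forall a b c : V, dW (sh a) (sh b) (sh c) = 0) /\
  (forall a b : V, dT (sh a) (sh b) = 0).
Proof.
have Ls := lam_smooth Ao hat_smooth tau_mx_smooth WT.
have Lsk y : A y -> (lam_mx (W y) (T y))^T = - lam_mx (W y) (T y).
  by move=> Ay; apply: lam_skew (WT Ay).
have QE y : A y -> forall x z, Q y (rows2 x z) = bil (lam_mx (W y) (T y)) x z.
  by move=> Ay x z; apply: bivectorE.
have Lswap (x z : V) : bil Lu z x = - bil Lu x z.
  by rewrite -bil_tr Lsk // bilN.
pose rest a b c := (dT (sh a) (sh b) *m Ru *m c^T) 0 0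
  + (dT (sh b) (sh c) *m Ru *m a^T) 0 0 + (dT (sh c) (sh a) *m Ru *m b^T) 0 0.
have H (a b c : V) : (@schouten R m 1 1 Q Q u (rows3 a b c) =
     - 2 * wedge (vec1 (E u)) (Q u) (rows3 a b c)) <->
   dW (sh a) (sh b) (sh c) = rest a b c.
  have S := @schouten_bivector R m A Ao u Au Q _ Ls Lsk QE a b c.
  have J := jacobi_LL_defect Ao hat_smooth tau_mx_smooth WT Au E a b c.
  have B : wedge (vec1 (E u)) (Q u) (rows3 a b c) =
    (a *m (E u)^T) 0 0 * bil Lu b c + (b *m (E u)^T) 0 0 * bil Lu c a
     + (c *m (E u)^T) 0 0 * bil Lu a b.
    rewrite wedge12E; last by apply: skew2 => x z; rewrite !QE.
    by rewrite /= !bivectorE // (Lswap a c) mulrN.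
  rewrite S B; move: J; rewrite -/(rest a b c).
  move: (bil _ b c + _ + _) (_ * bil Lu b c + _ + _) => X Y J.
  split=> [XY|d].
    have : X + Y = 0.
      have n2 : (2 : R) != 0 by rewrite pnatr_eq0.
      by apply: (mulfI n2); rewrite mulr0 mulrDr XY; ring.
    by rewrite J => /eqP; rewrite subr_eq0 => /eqP.
  have : X + Y = 0 by rewrite J d subrr.
  by move/eqP; rewrite addr_eq0 => /eqP ->; ring.
split=> [H0|[HW HT] v]; last first.
  have [a [b [c ->]]] := rows3P v; apply/H.
  by rewrite HW /rest !HT !mul0mx !mxE !addr0.
have H1 a b c := (H a b c).1 (H0 _).
have HT a b : dT (sh a) (sh b) = 0.
  apply/rowP => k; have := H1 a b (row k (T u)^T).
  rewrite /rest dual_sharp defect_W_0.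
  have [-> _] := defect_T_0 (sh b); have [_ ->] := defect_T_0 (sh a).
  by rewrite reeb_coord !mul0mx !mxE !addr0 => <-.
by split=> // a b c; rewrite H1 /rest !HT !mul0mx !mxE !addr0.
Qed.

(** As for [jacobi_LL_equiv], with b = tau_k in [jacobi_LE_defect]. *)
Lemma jacobi_LE_equiv :
  (@schouten R m 1 0 Q (fun y => vec1 (E y)) u =1 (fun=> 0)) <->
  (forall a : V, lT (sh a) = 0) /\ (forall a b : V, lW (sh a) (sh b) = 0).
Proof.
have Ls := lam_smooth Ao hat_smooth tau_mx_smooth WT.
have Lsk y : A y -> (lam_mx (W y) (T y))^T = - lam_mx (W y) (T y).
  by move=> Ay; apply: lam_skew (WT Ay).
have QE y : A y -> forall x z, Q y (rows2 x z) = bil (lam_mx (W y) (T y)) x z.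
  by move=> Ay x z; apply: bivectorE.
have H (a b : V) : @schouten R m 1 0 Q (fun y => vec1 (E y)) u (rows2 a b) =
   - lW (sh a) (sh b) + (lT (sh a) *m Ru *m b^T) 0 0 - (lT (sh b) *m Ru *m a^T) 0 0.
  apply: etrans (@schouten_vector R m A Ao u Au Q _ Ls Lsk QE E a b Es) _.
  exact: (jacobi_LE_defect Ao hat_smooth tau_mx_smooth WT Au E a b).
split=> [H0|[HT HW] v]; last first.
  have [a [b ->]] := rows2P v.
  by rewrite H HW !HT !mul0mx !mxE oppr0 !addr0.
have HT a : lT (sh a) = 0.
  apply/rowP => k; have := H a (row k (T u)^T); rewrite H0 dual_sharp.
  by rewrite lie_W_0 lie_T_0 reeb_coord !mul0mx !mxE oppr0 add0r addr0 => <-.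
split=> // a b; have := H a b; rewrite H0 !HT !mul0mx !mxE subr0 addr0.
by move/esym/eqP; rewrite oppr_eq0 => /eqP.
Qed.

End LocalEquivalences.

(** * Restriction to the horizontal space by wedging with the tau's *)

Section WedgeWithVolume.
Local Open Scope ring_scope.
Variables (R : realType) (m : nat).
Local Notation V := 'rV[R]_m.

(** In every other term of the expansion x is an argument of b. *)
Lemma wedge1_null l (a : tensor R m 1) (b : tensor R m l) x (v : 'M[R]_(l, m)) :
  null_vector b x -> wedge1 a b (col_mx x v : 'M[R]_(1 + l, m)) = a x * b v.
Proof.
move=> b0; rewrite wedge1_cons big1 ?subr0 // => i _.
case: (unliftP (lift ord0 i) ord0) => [j Ej|]; last by [].
by rewrite (b0 _ j) ?mulr0 // row_row' -Ej row0_col_mx.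
Qed.

Lemma wedge2_null l (a : tensor R m 2) (b : tensor R m l) x (v : 'M[R]_(l.+1, m)) :
  multilinear a -> (forall x y, a (rows2 y x) = - a (rows2 x y)) -> skew b ->
  null_vector b x ->
  wedge a b (col_mx x v : 'M[R]_(1 + l.+1, m)) = wedge1 (fun y => a (rows2 x y)) b v.
Proof.
move=> aM aS; case: l b v => [|l] b v bS b0.
  rewrite (wedge2_0 _ (col_mx x v : 'M[R]_(2, m)) aS) /wedge1 big_ord1 expr0 mul1r.
  congr (a _ * b _); last by rewrite [RHS]flatmx0.
  by rewrite /rows2 row0_id.
rewrite [LHS](contract_wedge2 x v aM aS bS) [X in _ + X](_ : _ = 0) ?addr0 //.
rewrite /wedge big1 ?mulr0 // => s _.
rewrite /tprod /contract (b0 _ ord0) ?mulr0 // row0_col_mx //.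
Qed.

Variables (p : nat) (w : tensor R m 2) (tau : 'I_p -> tensor R m 1).
Hypothesis tM : forall k, multilinear (tau k).
Local Notation W := (hat w).
Local Notation T := (tau_mx tau).
Hypothesis WT : nondegenerate W T.
Local Notation Rm := (reeb_mx W T).
Local Notation P := (proj_H W T).

Lemma wedge_all_mulmx (v : 'M[R]_(p, m)) : wedge_all tau v = \det (v *m T).
Proof.
rewrite wedge_all_det //; congr (\det _); apply/matrixP=> i k.
by rewrite mxE tauE // -row_mul mxE.
Qed.

Lemma wedge_all_proj_null (x : V) : null_vector (wedge_all tau) (x *m P).
Proof.
apply: wedge_all_null => k v i; rewrite (ord1 i) row0_id => ->.
by rewrite tauE // -mulmxA (proj_T WT) mulmx0 mxE.
Qed.

Lemma wedge_all_reeb : wedge_all tau Rm = 1.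
Proof. by rewrite wedge_all_mulmx (reeb_T WT) det1. Qed.

End WedgeWithVolume.

(** A repeated factor: moving tau_k to the place of its double changes only the sign, and
   the wedge square of a 1-form vanishes. *)
Lemma wedge1_wedge_all (R : realType) m p (t : 'I_p -> tensor R m 1) k v :
  wedge1 (t k) (wedge_all t) v = 0%R.
Proof.
elim: p t k v => [t [] //|p IHp t k v].
set b := wedge_all (fun i => t (lift ord0 i)).
have bS : skew b by exact: wedge_all_skew.
have E z : wedge_all t z = wedge1 (t ord0) b z by exact: wedge1E.
rewrite (wedge1_eqr _ _ E) wedge1C //.
case: (unliftP ord0 k) => [j|] ->.
  by rewrite (wedge1_eqr _ _ (IHp (fun i => t (lift ord0 i)) j)) /wedge1 big1
    ?oppr0 // => i _; rewrite !mulr0.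
have : wedge1 (t ord0) (wedge1 (t ord0) b) v = (- wedge1 (t ord0) (wedge1 (t ord0) b) v)%R.
  exact: wedge1C.
by move=> /eqP; rewrite -subr_eq0 opprK -mulr2n mulrn_eq0 /= => /eqP ->; rewrite oppr0.
Qed.

Section WedgeWithVolumeEquivalences.
Local Open Scope ring_scope.
Variables (R : realType) (m : nat).
Local Notation V := 'rV[R]_m.
Variables (p : nat) (w : tensor R m 2) (tau : 'I_p -> tensor R m 1).
Hypothesis tM : forall k, multilinear (tau k).
Local Notation W := (hat w).
Local Notation T := (tau_mx tau).
Hypothesis WT : nondegenerate W T.
Local Notation Rm := (reeb_mx W T).
Local Notation P := (proj_H W T).

Lemma proj_decomp (x : V) : x = x *m P + \sum_k tau k x *: row k Rm.
Proof.
rewrite mulmxBr mulmx1 mulmxA [x *m T *m Rm]mulmx_sum_row.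
rewrite [X in _ + X](_ : _ = \sum_k (x *m T) 0 k *: row k Rm) ?subrK //.
by apply: eq_bigr => k _; rewrite tauE.
Qed.

(** Evaluation at x P, R_1, ..., R_p gives one direction. For the other one, a form that
   vanishes on H equals the sum of the a(R_k) tau_k. *)
Lemma wedge_volume1 (a : tensor R m 1) : multilinear a ->
  (wedge a (wedge_all tau) =1 (fun=> 0)) <-> (forall x : V, a (x *m P) = 0).
Proof.
move=> aM; have bS := wedge_all_skew tau; split=> [H x | H v].
  have := H (col_mx (x *m P) Rm : 'M[R]_(1 + p, m)).
  rewrite wedge1E // wedge1_null; last exact: wedge_all_proj_null.
  by rewrite wedge_all_reeb // mulr1.
rewrite wedge1E //.
have -> : a = (fun x => \sum_k a (row k Rm) * tau k x).
  apply/funext => x; rewrite {1}[x]proj_decomp !tensor1E //.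
  rewrite mulmxDl mxE -tensor1E // H add0r mulmx_suml summxE.
  by apply: eq_bigr => k _; rewrite -scalemxAl mxE -tensor1E // mulrC.
by rewrite wedge1_suml big1 // => k _; rewrite wedge1_wedge_all mulr0.
Qed.

(** As for 1-forms. A 2-form that vanishes on H splits into a sum of tensor products
   with one factor among the tau_k, according to [proj_decomp] in each argument. *)
Lemma wedge_volume2 (a : tensor R m 2) : multilinear a ->
  (forall x y, a (rows2 y x) = - a (rows2 x y)) ->
  (wedge a (wedge_all tau) =1 (fun=> 0)) <->
  (forall x y : V, a (rows2 (x *m P) (y *m P)) = 0).
Proof.
move=> aM aS; have bS := wedge_all_skew tau; split=> [H x y | H v].
  have := H (col_mx (x *m P) (col_mx (y *m P) Rm : 'M[R]_(1 + p, m))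
     : 'M[R]_(1 + p.+1, m)).
  rewrite wedge2_null //; last exact: wedge_all_proj_null.
  rewrite wedge1_null; last exact: wedge_all_proj_null.
  by rewrite wedge_all_reeb // mulr1.
pose f k := tprod (tau k) (fun y => a (rows2 (row k Rm) y)).
pose g k := tprod (fun x => a (rows2 (x *m P) (row k Rm))) (tau k).
have aE z : a z = \sum_k f k z + \sum_k g k z.
  have [x [y ->]] := rows2P z.
  have l1 s t z1 : a (rows2 (s + t) z1) = a (rows2 s z1) + a (rows2 t z1).
    by rewrite !tensor2E // !mulmxDl mxE.
  have l2 s t z1 : a (rows2 z1 (s + t)) = a (rows2 z1 s) + a (rows2 z1 t).
    by rewrite !tensor2E // linearD /= mulmxDr mxE.
  rewrite {1}[x]proj_decomp l1 addrC; congr (_ + _).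
    rewrite tensor2E // -mulmxA mulmx_suml summxE; apply: eq_bigr => k _.
    by rewrite -scalemxAl mxE mulmxA -tensor2E // /f /tprod /rows2 col_mxKu col_mxKd.
  rewrite {1}[y]proj_decomp l2 H add0r.
  rewrite tensor2E // linear_sum /= mulmx_sumr summxE; apply: eq_bigr => k _.
  rewrite linearZ /= -scalemxAr mxE -tensor2E //.
  by rewrite mulrC /g /tprod /rows2 col_mxKu col_mxKd.
have -> : a = (fun z => \sum_(i : bool) (fun i z => if i then \sum_k f k z
    else \sum_k g k z) i z).
  by apply/funext => z; rewrite big_bool aE.
rewrite wedge_suml big_bool /= !wedge_suml !big1 ?addr0 // => k _.
  rewrite wedge_tprodE // (wedge1_eqr _ _ (wedge1_wedge_all tau k)).
  by rewrite /wedge1 big1 ?mulr0 // => i _; rewrite !mulr0.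
rewrite wedge_tprodC wedge_tprodE // (wedge1_eqr _ _ (wedge1_wedge_all tau k)).
by rewrite /wedge1 big1 ?mulr0 ?oppr0 // => i _; rewrite !mulr0.
Qed.

End WedgeWithVolumeEquivalences.

(** * Change of chart *)

Section TensorsFromMatrices.
Local Open Scope ring_scope.
Variables (R : realType) (m : nat).
Local Notation V := 'rV[R]_m.

Lemma linear_multilinear (a : tensor R m 1) :
  (forall b1 b2 (x y : V), a (b1 *: x + b2 *: y) = b1 * a x + b2 * a y) ->
  multilinear a.
Proof.
move=> aL v v1 v2 i b1 b2; rewrite (ord1 i) !row0_id => -> _ _; exact: aL.
Qed.

Lemma alternating1 (a : tensor R m 1) : alternating a.
Proof. by move=> v i j; rewrite (ord1 i) (ord1 j). Qed.

Lemma bil_linearl (M : 'M[R]_m) b1 b2 (x y z : V) :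
  bil M (b1 *: x + b2 *: y) z = b1 * bil M x z + b2 * bil M y z.
Proof. by rewrite /bil !mulmxDl -!scalemxAl !mxE. Qed.

Lemma bil_linearr (M : 'M[R]_m) b1 b2 (x y z : V) :
  bil M z (b1 *: x + b2 *: y) = b1 * bil M z x + b2 * bil M z y.
Proof. by rewrite -!(bil_tr M) bil_linearl. Qed.

Lemma bil_multilinear (a : tensor R m 2) (M : 'M[R]_m) :
  (forall x y, a (rows2 x y) = bil M x y) -> multilinear a.
Proof.
move=> aE v v1 v2 i b1 b2.
rewrite -[v]rows2K -[v1]rows2K -[v2]rows2K !aE.
have [->|->] : i = ord0 \/ i = lift ord0 ord0.
  by case: (i) => [[|[|k]] Hk] //; [left|right]; apply: ord_inj.
- by rewrite !rowsE => -> -> ->; apply: bil_linearl.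
- by rewrite !rowsE => -> -> ->; apply: bil_linearr.
Qed.

Lemma bil_alternating (a : tensor R m 2) (M : 'M[R]_m) : M^T = - M ->
  (forall x y, a (rows2 x y) = bil M x y) -> alternating a.
Proof.
move=> Msk aE v i j ij Eij.
have M0 x : bil M x x = 0.
  have := bil_tr M x x; rewrite Msk bilN => /eqP.
  by rewrite -subr_eq0 -opprD oppr_eq0 -mulr2n mulrn_eq0 /= => /eqP.
rewrite -[v]rows2K aE.
suff -> : row ord0 v = row (lift ord0 ord0) v by [].
move: ij Eij; have two (k : 'I_2) : k = ord0 \/ k = lift ord0 ord0.
  by case: k => [[|[|k]] Hk] //; [left|right]; apply: ord_inj.
by have [->|->] := two i; have [->|->] := two j.
Qed.

End TensorsFromMatrices.

Section ChangeOfChart.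
Local Open Scope ring_scope.
Variables (F : fieldType) (m p : nat) (W W' J : 'M[F]_m) (T T' : 'M[F]_(m, p)).
Hypotheses (EW : W = J *m W' *m J^T) (ET : T = J *m T').
Hypothesis Bu : Bmx W T \in unitmx.
Hypothesis Bu' : Bmx W' T' \in unitmx.

(** Row vectors and covectors transform by J and by J^-t; J is invertible because
   both matrices B are. *)
Lemma Bmx_change : Bmx W T = J *m Bmx W' T' *m J^T.
Proof. by rewrite /Bmx EW ET trmx_mul mulmxDr mulmxDl !mulmxA. Qed.

Lemma invB_change : invmx (Bmx W' T') = J^T *m invmx (Bmx W T) *m J.
Proof.
have Ju : J \in unitmx.
  by move: Bu; rewrite Bmx_change !unitmx_mul => /andP[/andP[]].
have E : Bmx W' T' *m (J^T *m invmx (Bmx W T) *m J) = 1%:M.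
  apply: (can_inj (mulKmx Ju)); rewrite mulmx1 !mulmxA -Bmx_change.
  by rewrite mulmxV // mul1mx.
by rewrite -[RHS](mulKmx Bu') E mulmx1.
Qed.

Lemma lam_mx_change : lam_mx W' T' = J^T *m lam_mx W T *m J.
Proof.
rewrite /lam_mx invB_change EW mulmxN mulNmx; congr (- _).
by rewrite !trmx_mul trmxK !mulmxA.
Qed.

Lemma reeb_mx_change : reeb_mx W' T' = reeb_mx W T *m J.
Proof. by rewrite /reeb_mx invB_change ET trmx_mul !mulmxA. Qed.

End ChangeOfChart.

(** * The fields Lambda and X_alpha on the manifold *)

Section Fields.
Local Open Scope classical_set_scope.
Local Open Scope ring_scope.
Variables (R : realType) (m p : nat) (M : manifold R m).
Variables (w : tfield M 2) (tau : 'I_p -> tfield M 1).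
Hypotheses (wF : is_form w) (tF : forall k, is_form (tau k)).
Local Notation V := 'rV[R]_m.
Local Notation W c u := (hat (w c u)).
Local Notation T c u := (tau_mx (fun k => tau k c u)).
Hypothesis WT : forall (c : chart M) u, ctgt c u -> nondegenerate (W c u) (T c u).

Lemma form_hat_smooth c : smooth_mx (ctgt c) (fun u => W c u).
Proof. exact: (@hat_smooth R m (ctgt c) (@ctgt_open R m M c) (w c) (form_smooth wF c)). Qed.

Lemma form_tau_smooth c : smooth_mx (ctgt c) (fun u => T c u).
Proof. exact: (@tau_mx_smooth R m p (ctgt c) (@ctgt_open R m M c) (fun k => tau k c) (fun k => form_smooth (tF k) c)). Qed.

Lemma formE2 c u (a b : V) : ctgt c u -> w c u (rows2 a b) = bil (W c u) a b.
Proof. by move=> cu; rewrite tensor2E //; apply: form_multilinear wF _ _ cu. Qed.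

Lemma formE1 k c u (a : V) : ctgt c u -> tau k c u a = (a *m T c u) 0 k.
Proof.
move=> cu; rewrite (tauE (tau := fun k => tau k c u)) // => j.
exact: form_multilinear (tF j) _ _ cu.
Qed.

Lemma hat_change c c' x : csrc c x -> csrc c' x ->
  W c (cmap c x) =
  transJ c c' x *m W c' (cmap c' x) *m (transJ c c' x)^T.
Proof.
move=> cx c'x; set J := transJ c c' x; apply/matrixP=> i j.
rewrite [LHS]mxE (form_change wF _ cx c'x) rows2_mul -/J formE2; last exact: cmap_tgt.
have E (N : 'M[R]_m) : N i j = bil N (delta_mx 0 i) (delta_mx 0 j).
  by rewrite bil_delta -rowE mxE.
by rewrite [RHS]E bil_mul trmxK.
Qed.

Lemma tau_change c c' x : csrc c x -> csrc c' x ->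
  T c (cmap c x) = transJ c c' x *m T c' (cmap c' x).
Proof.
move=> cx c'x; apply/matrixP=> i k; rewrite [LHS]mxE (form_change (tF k) _ cx c'x).
by rewrite (formE1 _ _ (cmap_tgt c'x)) -mulmxA -rowE mxE.
Qed.

Lemma Lam_fieldE c u (a b : V) : ctgt c u ->
  Lam_field w tau c u (rows2 a b) = bil (lam_mx (W c u) (T c u)) a b.
Proof. by move=> cu; rewrite /Lam_field LamE //; apply: form_multilinear wF _ _ cu. Qed.

Lemma is_multivector_Lam : is_multivector (Lam_field w tau).
Proof.
split=> [c u cu|c u cu|c eta|c c' x eta cx c'x].
- by apply: bil_multilinear => a b; apply: Lam_fieldE.
- apply: bil_alternating (lam_skew (WT cu)) _ => a b; exact: Lam_fieldE.
- have [a [b ->]] := rows2P eta.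
  have Ls := lam_smooth (@ctgt_open R m M c) (@form_hat_smooth c) (@form_tau_smooth c) (@WT c).
  have := smooth_mx_mul (@ctgt_open R m M c) (smooth_mx_mul (@ctgt_open R m M c)
     (smooth_mx_cst (ctgt c) a) Ls) (smooth_mx_cst (ctgt c) b^T).
  move=> /(_ 0 0); apply: (smooth_eq (@ctgt_open R m M c)) => u cu.
  by rewrite Lam_fieldE.
- have [a [b ->]] := rows2P eta; rewrite rows2_mul.
  rewrite (Lam_fieldE _ _ (cmap_tgt cx)) (Lam_fieldE _ _ (cmap_tgt c'x)).
  rewrite (lam_mx_change (hat_change cx c'x) (tau_change cx c'x)).
  + by rewrite bil_mul.
  + exact: Bmx_unit (WT (cmap_tgt cx)).
  + exact: Bmx_unit (WT (cmap_tgt c'x)).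
Qed.

Section Converse.
Variables (abar : tfield M 1) (lam : 'I_p -> M -> R).
Hypotheses (aF : is_form abar) (aH : horizontal w abar).
Hypothesis lamS : forall k, smooth_function (lam k).
Local Notation X := (X_alpha w tau abar lam).
Local Notation lamrow x := (\row_k lam k x).

Lemma X_alphaE c u : X c u =
  covec (abar c u) *m (invmx (Bmx (W c u) (T c u)))^T
  - lamrow (cinv c u) *m reeb_mx (W c u) (T c u).
Proof.
rewrite /X_alpha /tBhat_inv hat_Btensor -trmx_inv; congr (_ - _).
rewrite mulmx_sum_row; apply: eq_bigr => k _; rewrite mxE; congr (_ *: _).
rewrite /Reeb /Bhat_inv hat_Btensor /reeb_mx row_mul; congr (_ *m _).
by apply/rowP=> j; rewrite !mxE.
Qed.

Lemma abarE c u (a : V) : ctgt c u -> abar c u a = (a *m (covec (abar c u))^T) 0 0.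
Proof. by move=> cu; rewrite tensor1E //; apply: form_multilinear aF _ _ cu. Qed.

Lemma abar_reeb c u : ctgt c u ->
  covec (abar c u) *m (reeb_mx (W c u) (T c u))^T = 0.
Proof.
move=> cu; apply: trmx_inj; rewrite trmx_mul trmxK trmx0.
apply/row_matrixP => k; rewrite row_mul row0; apply/rowP=> j; rewrite (ord1 j).
rewrite -abarE // (aH cu) ?mxE //; apply/sub_kermxP.
by rewrite -row_mul (reeb_W (WT cu)) row0.
Qed.

Lemma X_alpha_tau c u : ctgt c u -> X c u *m T c u = - lamrow (cinv c u).
Proof.
move=> cu; rewrite X_alphaE mulmxBl -[_ *m reeb_mx _ _ *m _]mulmxA (reeb_T (WT cu)).
rewrite mulmx1 -[covec _ *m _ *m _]mulmxA.
have -> : (invmx (Bmx (W c u) (T c u)))^T *m T c u = (reeb_mx (W c u) (T c u))^T.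
  by rewrite /reeb_mx trmx_mul trmxK.
by rewrite abar_reeb // sub0r.
Qed.

(** The vertical part of X_alpha is killed by omega, and W B^-1 is the projection onto H. *)
Lemma X_alpha_w c u (a : V) : ctgt c u -> abar c u a = bil (W c u) a (X c u).
Proof.
move=> cu; rewrite abarE // X_alphaE /bil.
set B := Bmx _ _; set Rm := reeb_mx _ _; set l := lamrow _; set e := covec _.
have -> : (e *m (invmx B)^T - l *m Rm)^T = invmx B *m e^T - Rm^T *m l^T.
  by rewrite raddfB /= !trmx_mul trmxK.
rewrite mulmxBr -[a *m W c u *m (Rm^T *m _)]mulmxA [W c u *m (Rm^T *m _)]mulmxA.
rewrite (W_reeb (WT cu)) mul0mx mulmx0 subr0 mulmxA -[a *m _ *m invmx B]mulmxA.
rewrite (W_invB (WT cu)) /proj_H mulmxBr mulmx1 mulmxBl.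
suff -> : a *m (T c u *m Rm) *m e^T = 0 by rewrite subr0.
rewrite -[a *m _ *m e^T]mulmxA -[T c u *m Rm *m e^T]mulmxA.
have -> : Rm *m e^T = 0; last by rewrite !mulmx0.
by apply: trmx_inj; rewrite trmx_mul trmxK abar_reeb // trmx0.
Qed.

Lemma covec_smooth c : smooth_mx (ctgt c) (fun u => covec (abar c u)).
Proof.
move=> i j; have := form_smooth aF c (delta_mx 0 j).
by apply: (smooth_eq (@ctgt_open R m M c)) => u _; rewrite mxE.
Qed.

Lemma X_alpha_smooth c : smooth_mx (ctgt c) (X c).
Proof.
have Ao := @ctgt_open R m M c; have Ws := @form_hat_smooth c; have Ts := @form_tau_smooth c.
have Bs := invB_smooth Ao Ws Ts (@WT c).
have Rs := reeb_smooth Ao Ws Ts (@WT c).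
have ls : smooth_mx (ctgt c) (fun u => lamrow (cinv c u)).
  by move=> i k; apply: (smooth_eq Ao) (lamS k c) => u _; rewrite mxE.
have := smooth_mx_add Ao (smooth_mx_mul Ao (@covec_smooth c) (smooth_mx_tr Ao Bs))
  (smooth_mx_opp Ao (smooth_mx_mul Ao ls Rs)).
by move=> H i j; apply: (smooth_eq Ao) (H i j) => u _; rewrite X_alphaE.
Qed.

Lemma X_alpha_vector_field : is_vector_field X.
Proof.
split=> [c|c c' x cx c'x]; first exact/(smooth_mx_rV (@ctgt_open R m M c))/X_alpha_smooth.
rewrite !X_alphaE !cmapK //; set J := transJ c c' x.
have cu := cmap_tgt cx; have c'u := cmap_tgt c'x.
have EW := hat_change cx c'x; have ET := tau_change cx c'x.
have Bu := Bmx_unit (WT cu); have Bu' := Bmx_unit (WT c'u).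
rewrite (invB_change EW ET Bu Bu') (reeb_mx_change EW ET Bu Bu') -/J.
rewrite mulmxBl -[lamrow x *m _ *m J]mulmxA; congr (_ - _).
have -> : covec (abar c (cmap c x)) = covec (abar c' (cmap c' x)) *m J^T.
  apply/rowP=> j; rewrite mxE (form_change aF _ cx c'x) abarE //.
  by rewrite -mulmxA -[J *m _]trmxK trmx_mul trmxK -rowE !mxE.
by rewrite !trmx_mul trmxK !mulmxA.
Qed.

Lemma lam_X_alpha k c u : ctgt c u -> lam k (cinv c u) = - (X c u *m T c u) 0 k.
Proof. by move=> cu; rewrite X_alpha_tau // !mxE opprK. Qed.

End Converse.

End Fields.

(** * Completion to a Jacobi structure *)

Section JacobiCompletion.
Local Open Scope classical_set_scope.
Local Open Scope ring_scope.
Variables (R : realType) (m p : nat) (M : manifold R m).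
Variables (w : tfield M 2) (tau : 'I_p -> tfield M 1).
Hypotheses (wF : is_form w) (tF : forall k, is_form (tau k)).
Local Notation V := 'rV[R]_m.
Local Notation W c u := (hat (w c u)).
Local Notation T c u := (tau_mx (fun k => tau k c u)).
Hypothesis WT : forall (c : chart M) u, ctgt c u -> nondegenerate (W c u) (T c u).

(** The bracket depends on its second argument through the germ at u only. *)
Lemma schouten_eqr (a b : nat) (A : set V) (P : lfield R m (a + 1))
    (Q Q' : lfield R m (1 + b)) u : open A -> A u -> (forall y, A y -> Q y = Q' y) ->
  schouten P Q u = schouten P Q' u.
Proof.
move=> Ao Au QQ; apply/funext => eta; rewrite /schouten; apply: eq_bigr => l _.
have -> : (fun z => 'D_(delta_mx 0 l) (fun y => Q y z) u) =
          (fun z => 'D_(delta_mx 0 l) (fun y => Q' y z) u).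
  apply/funext => z; apply: near_eq_derive; apply: (open_near Ao Au) => y Ay.
  by rewrite QQ.
by rewrite (QQ _ Au).
Qed.

Section GivenData.
Variables (abar : tfield M 1) (lam : 'I_p -> M -> R).
Hypotheses (aF : is_form abar) (aH : horizontal w abar).
Hypothesis lamS : forall k, smooth_function (lam k).
Local Notation X := (X_alpha w tau abar lam).
Local Notation prHu c u := (prH_field w tau c u).

Section AtAPoint.
Variables (c : chart M) (u : V).
Hypothesis cu : ctgt c u.

Let Ao := @ctgt_open R m M c.
Let wM := @form_multilinear R m M 2 w wF c.
Let wS := form_smooth wF c.
Let tM k := @form_multilinear R m M 1 (tau k) (tF k) c.
Let tS k := form_smooth (tF k) c.
Let Xs := @X_alpha_smooth R m p M w tau wF tF WT abar lam aF lamS c.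
Let aE (x : V) := X_alpha_w WT lam aF aH x cu.
Let lE k y (cy : ctgt c y) := lam_X_alpha WT lam aF aH k cy.

Lemma jacobi_LL_conditions :
  (@schouten R m 1 1 (Lam_field w tau c) (Lam_field w tau c) u
     =1 (fun eta => - 2 * wedge (vec_tfield X c u) (Lam_field w tau c u) eta)) <->
  (pullback (prHu c u) (dext (w c) u)
     =1 wedge (abar c u) (pullback (prHu c u) (w c u))) /\
  (forall k, pullback (prHu c u) (dext (tau k c) u)
     =1 (fun v => lam k (cinv c u) * pullback (prHu c u) (w c u) v)).
Proof.
have H1 := @condition_i_defect R m p _ Ao (w c) (fun k => tau k c) wM wS (@WT c) u cu
  (X c) (abar c u) aE.
have H2 := @condition_ii_defect R m p _ Ao (w c) (fun k => tau k c) wM tM tS (@WT c) u cu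
  (X c) (fun k y => lam k (cinv c y)) lE.
have HJ := @jacobi_LL_equiv R m p _ Ao (w c) (fun k => tau k c) wM wS tS (@WT c) u cu (X c).
split=> [/HJ[d1 d2]|[/H1 d1 /H2 d2]]; last exact/HJ.
by split; [apply/H1 | apply/H2].
Qed.

Lemma jacobi_LE_conditions :
  (@schouten R m 1 0 (Lam_field w tau c) (vec_tfield X c) u =1 (fun=> 0)) <->
  (forall k, pullback (prHu c u) (contract (X c u) (dext (tau k c) u))
     =1 pullback (prHu c u) (dfun (lam k \o cinv c) u)) /\
  (pullback (prHu c u) (lie (X c) (w c) u) =1 (fun=> 0)).
Proof.
have H1 := @condition_iii_tau_defect R m p _ Ao (w c) (fun k => tau k c) tM tS (@WT c) u cu
  (X c) Xs (fun k y => lam k (cinv c y)) lE.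
have H2 := @condition_iii_w_defect R m p _ Ao (w c) (fun k => tau k c) wM wS (@WT c) u cu
  (X c) Xs.
have HJ := @jacobi_LE_equiv R m p _ Ao (w c) (fun k => tau k c) wM wS tS (@WT c) u cu (X c) Xs.
split=> [/HJ[d1 d2]|[/H1 d1 /H2 d2]]; last exact/HJ.
by split; [apply/H1 | apply/H2].
Qed.

End AtAPoint.

Lemma conditions_jacobi :
  cond_i w tau abar -> cond_ii w tau lam ->
  (forall k, cond_iii_tau w tau abar lam k) -> cond_iii_w w tau abar lam ->
  jacobi_structure (Lam_field w tau) X.
Proof.
move=> ci cii ciii ciiiw; split.
- exact: is_multivector_Lam.
- exact: X_alpha_vector_field.
- by move=> c u cu; apply/jacobi_LL_conditions => //; split=> [|k]; [apply: ci|apply: cii].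
- by move=> c u cu; apply/jacobi_LE_conditions => //; split=> [k|]; [apply: ciii|apply: ciiiw].
Qed.

Lemma cond_iii_tau_wedgeP k :
  cond_iii_tau w tau abar lam k <-> cond_iii_tau_wedge w tau abar lam k.
Proof.
have H c u : ctgt c u ->
    pullback (prHu c u) (contract (X c u) (dext (tau k c) u))
      =1 pullback (prHu c u) (dfun (lam k \o cinv c) u) <->
    wedge (fun v => contract (X c u) (dext (tau k c) u) v - dfun (lam k \o cinv c) u v)
      (wedge_all (fun j => tau j c u)) =1 (fun=> 0).
  move=> cu; set a := fun v : V => _ - _.
  have aM : multilinear a.
    have E (x : V) : contract (X c u) (dext (tau k c) u) x =
        (extd_T (fun y => T c y) u (X c u) x) 0 k.
      exact: (@dext_form1 R m p _ (@ctgt_open R m M c) (fun k => tau k c)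
        (fun k => @form_multilinear R m M 1 (tau k) (tF k) c)
        (fun k => form_smooth (tF k) c) u cu k (X c u) x).
    have ld : differentiable (lam k \o cinv c) u.
      exact: smooth_differentiable (lamS k c) cu.
    apply: linear_multilinear => b1 b2 x y; rewrite /a.
    have -> : contract (X c u) (dext (tau k c) u) (b1 *: x + b2 *: y) =
        b1 * contract (X c u) (dext (tau k c) u) x
        + b2 * contract (X c u) (dext (tau k c) u) y.
      apply: (etrans (E _)).
      have lin := extd_T_linear cu b1 b2 x y (X c u) k (form_tau_smooth tF c).
      by apply: (etrans lin); congr (_ * _ + _ * _); apply/esym.
    rewrite /dfun !deriveE // linearP linearZ /= /GRing.scale /=.
    move: (contract _ _ x) (contract _ _ y) ('d _ u x) ('d _ u y) => *.
    ring.
  have tM j := @form_multilinear R m M 1 (tau j) (tF j) c u cu.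
  have := @wedge_volume1 R m p (w c u) (fun j => tau j c u) tM (WT cu) a aM.
  have PE := @prHE R m p _ (w c) (fun k => tau k c) (@WT c) u cu.
  rewrite /prH_field PE => ->.
  split=> [H x|H v].
    by have := H x; rewrite /pullback /a => ->; rewrite subrr.
  by have := H v; rewrite /a /pullback => /eqP; rewrite subr_eq0 => /eqP.
by split=> Hk c u cu; apply/H => //; apply: Hk.
Qed.

Lemma cond_iii_w_wedgeP :
  cond_iii_w w tau abar lam <-> cond_iii_w_wedge w tau abar lam.
Proof.
have H c u : ctgt c u ->
    pullback (prHu c u) (lie (X c) (w c) u) =1 (fun=> 0) <->
    wedge (lie (X c) (w c) u) (wedge_all (fun j => tau j c u)) =1 (fun=> 0).
  move=> cu; have Ao := @ctgt_open R m M c.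
  have Xs := @X_alpha_smooth R m p M w tau wF tF WT abar lam aF lamS c.
  have E x y := @lie_form2 R m _ Ao (w c) (@form_multilinear R m M 2 w wF c)
    (form_smooth wF c) u cu (X c) x y Xs.
  pose N := mxder (X c u) u (fun y => W c y).
  have lE x y : lie (X c) (w c) u (rows2 x y) = lie_W (fun y => W c y) u (X c) x y.
    exact: E.
  have aS x y : lie (X c) (w c) u (rows2 y x) = - lie (X c) (w c) u (rows2 x y).
    apply: (etrans (lE y x)); apply: etrans (esym (congr1 -%R (lE x y))).
    exact: (@lie_W_swap R m p _ Ao (fun y => W c y) (fun y => T c y)
      (form_hat_smooth wF c) (@WT c) u cu (X c) x y).
  have aM : multilinear (lie (X c) (w c) u).
    pose G : 'M[R]_m := \matrix_i mxder (delta_mx 0 i) u (X c).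
    have DG x : mxder x u (X c) = x *m G.
      rewrite (mxder_lincomb cu x Xs) mulmx_sum_row.
      by apply: eq_bigr => i _; rewrite rowK.
    apply: (@bil_multilinear R m _ (N + G *m W c u + W c u *m G^T)) => x y.
    rewrite lE /lie_W !DG -/N !bilD; congr (_ + _ + _).
      by rewrite /bil !mulmxA.
    by rewrite /bil trmx_mul !mulmxA.
  have tM j := @form_multilinear R m M 1 (tau j) (tF j) c u cu.
  have := @wedge_volume2 R m p (w c u) (fun j => tau j c u) tM (WT cu) _ aM aS.
  have PE := @prHE R m p _ (w c) (fun k => tau k c) (@WT c) u cu.
  rewrite /prH_field PE => ->.
  split=> [H x y|H v].
    by have := H (rows2 x y); rewrite /pullback rows2_mul.
  by have [x [y ->]] := rows2P v; rewrite /pullback rows2_mul.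
by split=> Hk c u cu; apply/H => //; apply: Hk.
Qed.

End GivenData.

Section FromJacobi.
Variable E : vfield M.
Hypothesis EF : is_vector_field E.

(** The data attached to a completion E of Lambda are omega(., E) and - tau_k(E). *)
Definition abar_of : tfield M 1 := fun c u v => w c u (rows2 v (E c u)).

Definition chart_at (x : M) : chart M := projT1 (cid (chart_cover x)).

(** A function on the manifold has to be defined without reference to a chart;
   [lam_ofE] says that the choice of the chart does not matter. *)
Definition lam_of (k : 'I_p) (x : M) : R :=
  - tau k (chart_at x) (cmap (chart_at x) x) (E (chart_at x) (cmap (chart_at x) x)).

Lemma lam_ofE k c u : ctgt c u -> lam_of k (cinv c u) = - tau k c u (E c u).
Proof.
move=> cu; rewrite /lam_of; set x := cinv c u; set c' := chart_at x.
have cx : csrc c x by exact: cinv_src.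
have c'x : csrc c' x by rewrite /c' /chart_at; case: cid.
have := form_change (tF k) (E c (cmap c x)) cx c'x.
by rewrite -(vector_field_change EF cx c'x) cinvK // => <-.
Qed.

Lemma E_smooth c : smooth_mx (ctgt c) (E c).
Proof. exact/(smooth_mx_rV (@ctgt_open R m M c))/(vector_field_smooth EF). Qed.

Lemma abar_of_form : is_form abar_of.
Proof.
split=> [c u cu|c u cu|c v|c c' x v cx c'x].
- apply: linear_multilinear => b1 b2 x y; rewrite /abar_of.
  exact: rows2_linearl (form_multilinear wF cu) _ _ _ _.
- exact: alternating1.
- have Ao := @ctgt_open R m M c.
  have := smooth_mx_mul Ao (smooth_mx_mul Ao (smooth_mx_cst (ctgt c) v)
    (form_hat_smooth wF c)) (smooth_mx_tr Ao (@E_smooth c)).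
  move=> /(_ 0 0); apply: (smooth_eq Ao) => u cu.
  by rewrite /abar_of (formE2 wF).
- rewrite /abar_of (form_change wF _ cx c'x) rows2_mul.
  by rewrite (vector_field_change EF cx c'x).
Qed.

Lemma abar_of_horizontal : horizontal w abar_of.
Proof.
move=> c u cu v /sub_kermxP v0.
by rewrite /abar_of (formE2 wF) // /bil v0 mul0mx mxE.
Qed.

Lemma lam_of_smooth k : smooth_function (lam_of k).
Proof.
move=> c; have Ao := @ctgt_open R m M c.
have := smooth_mx_opp Ao (smooth_mx_mul Ao (@E_smooth c) (form_tau_smooth tF c)).
move=> /(_ 0 k); apply: (smooth_eq Ao) => u cu.
by rewrite /= lam_ofE // (formE1 tF) // mxE.
Qed.

(** Both vectors have the same image under W and under T. *)
Lemma X_alpha_of c u : ctgt c u -> X_alpha w tau abar_of lam_of c u = E c u.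
Proof.
move=> cu; apply/eqP; rewrite -subr_eq0; apply/eqP; set X := X_alpha _ _ _ _ c u.
have aw x := X_alpha_w WT lam_of abar_of_form abar_of_horizontal x cu.
apply: (nondeg_ker (WT cu)); rewrite mulmxBl; apply/eqP; rewrite subr_eq0; apply/eqP.
  apply: trmx_inj; rewrite !trmx_mul (nondeg_skew (WT cu)) !mulNmx; congr (- _).
  apply/row_matrixP => i; apply/rowP => j; rewrite (ord1 j).
  have := aw (delta_mx 0 i); rewrite /abar_of (formE2 wF) // /bil.
  by rewrite -!mulmxA -!rowE => <-.
rewrite (X_alpha_tau WT lam_of abar_of_form abar_of_horizontal cu).
by apply/rowP => k; rewrite [LHS]mxE [X in - X]mxE lam_ofE // opprK (formE1 tF).
Qed.

End FromJacobi.

Lemma jacobi_completableP :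
  jacobi_completable (Lam_field w tau) <->
  exists (abar : tfield M 1) (lam : 'I_p -> M -> R),
     [/\ is_form abar, horizontal w abar & forall k, smooth_function (lam k)]
     /\ [/\ cond_i w tau abar, cond_ii w tau lam,
            (forall k, cond_iii_tau w tau abar lam k)
          & cond_iii_w w tau abar lam].
Proof.
split=> [[E [_ EF LL LE]]|[abar [lam [[aF aH lS] [ci cii ciii ciiiw]]]]]; last first.
  by exists (X_alpha w tau abar lam); apply: conditions_jacobi.
have aF := abar_of_form EF; have aH := @abar_of_horizontal E.
have lS := lam_of_smooth EF.
exists (abar_of E), (lam_of E); split; first by split.
have XE c u : ctgt c u -> X_alpha w tau (abar_of E) (lam_of E) c u = E c u.
  exact: X_alpha_of.
have H1 c u (cu : ctgt c u) := (jacobi_LL_conditions (lam_of E) aF aH cu).1.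
have H2 c u (cu : ctgt c u) := (jacobi_LE_conditions aF aH lS cu).1.
have J1 c u : ctgt c u -> @schouten R m 1 1 (Lam_field w tau c) (Lam_field w tau c) u
     =1 (fun eta => - 2 * wedge (vec_tfield (X_alpha w tau (abar_of E) (lam_of E)) c u)
          (Lam_field w tau c u) eta).
  by move=> cu eta; rewrite (LL c u cu) /vec_tfield XE.
have J2 c u : ctgt c u -> @schouten R m 1 0 (Lam_field w tau c)
    (vec_tfield (X_alpha w tau (abar_of E) (lam_of E)) c) u =1 (fun=> 0).
  move=> cu eta; rewrite -(LE c u cu eta); congr (_ eta).
  apply: (schouten_eqr _ (@ctgt_open R m M c) cu) => y cy.
  by rewrite /vec_tfield XE.
split=> [c u cu|k c u cu|k c u cu|c u cu].
- by have [] := H1 c u cu (J1 c u cu).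
- by have [_] := H1 c u cu (J1 c u cu); apply.
- by have [H _] := H2 c u cu (J2 c u cu); apply: H.
- by have [_] := H2 c u cu (J2 c u cu).
Qed.

End JacobiCompletion.

Theorem proposition5p10 (R : realType) (n p : nat) (M : manifold R (2 * n + p))
    (w : tfield M 2) (tau : 'I_p -> tfield M 1)
    (hcos : almost_cosymplectic w tau) :
  (jacobi_completable (Lam_field w tau) <->
   exists (abar : tfield M 1) (lam : 'I_p -> M -> R),
     [/\ is_form abar, horizontal w abar & forall k, smooth_function (lam k)]
     /\ [/\ cond_i w tau abar, cond_ii w tau lam,
            (forall k, cond_iii_tau w tau abar lam k)
          & cond_iii_w w tau abar lam])
  /\
  (forall (abar : tfield M 1) (lam : 'I_p -> M -> R),
     is_form abar -> horizontal w abar -> (forall k, smooth_function (lam k)) ->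
     (forall k, cond_iii_tau w tau abar lam k <->
                cond_iii_tau_wedge w tau abar lam k)
     /\ (cond_iii_w w tau abar lam <-> cond_iii_w_wedge w tau abar lam))
  /\
  (forall (abar : tfield M 1) (lam : 'I_p -> M -> R),
     is_form abar -> horizontal w abar -> (forall k, smooth_function (lam k)) ->
     cond_i w tau abar -> cond_ii w tau lam ->
     (forall k, cond_iii_tau w tau abar lam k) -> cond_iii_w w tau abar lam ->
     jacobi_structure (Lam_field w tau) (X_alpha w tau abar lam)).
Proof.
case: hcos => wF tF vol rk.
have WT (c : chart M) u : ctgt c u ->
    nondegenerate (hat (w c u)) (tau_mx (fun k => tau k c u)).
  move=> cu; have [v wv] := vol c u cu.
  exact: (cosymplectic_nondegenerate (form_multilinear wF cu)
    (fun k => form_multilinear (tF k) cu) erefl (form_alternating wF cu) wv (rk c u cu)).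
split; first exact: jacobi_completableP.
split=> abar lam aF aH lS; last exact: conditions_jacobi.
split=> [k|]; first exact: cond_iii_tau_wedgeP.
exact: cond_iii_w_wedgeP.
Qed.
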